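(* Let $G=(V,E)$ be a non-bipartite, infinite, simple, connected graph. Suppose that for some vertex $x$ of $G$ there are constants $c>0$ and $D\ge 1$ such that $$\sum_{y:\ \mathrm{dist}(x,y)\le r}d(y)\ge c\,(r+1)^D\qquad\text{for all } r\ge 0.$$ Then for all $\delta\in(0,2)$, $$\mu_x^*(\delta)\le C\,d(x)\,\delta^{D/(D+1)},\qquad \mu_x^{\mathcal Q}(\delta)\le C\,d(x)\,\delta^{D/(D+1)},\qquad C:=\frac{(D+1)^2}{c^{1/(D+1)}D^{2D/(D+1)}}.$$ Hence for all integers $t\ge1$, simple random walk satisfies $$p_t(x,x)\le 2C'd(x)\,t^{-D/(D+1)}\ \text{ if } t\text{ is even},\qquad p_t(x,x)\le C'd(x)\,t^{-D/(D+1)}\ \text{ if } t\text{ is odd},$$ where $C':=\frac{D+1}{c^{1/(D+1)}D^{(D-1)/(D+1)}}\,\Gamma\!\left(\frac{D}{D+1}\right)$.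
   Context: Graphs are undirected, unweighted and locally finite (every vertex has finite degree $d(x)$). $\mathrm{dist}$ is graph distance. Simple random walk moves from a vertex to a uniformly random neighbour; $p_t(x,y)$ is the probability that the walk started at $x$ is at $y$ at step $t$. $\ell^2(V,d)$ is the Hilbert space of functions on $V$ with $\langle f,g\rangle_d=\sum_x d(x)f(x)\overline{g(x)}$. The transition operator is $(Pf)(x)=\frac1{d(x)}\sum_{y\sim x}f(y)$, a bounded self-adjoint operator on $\ell^2(V,d)$; $\mathcal L=I-P$ and $\mathcal Q=I+P$. With $I_{\mathcal L},I_{\mathcal Q}$ the spectral projection-valued measures (resolutions of identity) of $\mathcal L,\mathcal Q$ and $\mathbf e_x=\mathbf 1_x/\sqrt{d(x)}$: $\mu_x^*(\delta)=\langle I_{\mathcal L}((0,\delta])\mathbf e_x,\mathbf e_x\rangle_d$ and $\mu_x^{\mathcal Q}(\delta)=\langle I_{\mathcal Q}([0,\delta])\mathbf e_x,\mathbf e_x\rangle_d$. $\Gamma$ is the Gamma function. *)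

(* Defs.v *)
From mathcomp Require Import all_boot all_order all_algebra finmap.
From mathcomp Require Import all_classical all_reals all_analysis.
From mathcomp Require Import complex.

Set Implicit Arguments.
Unset Strict Implicit.
Unset Printing Implicit Defensive.

Import Order.TTheory GRing.Theory Num.Theory.
Import numFieldNormedType.Exports.

Local Open Scope classical_set_scope.
Local Open Scope complex_scope.
Local Open Scope ring_scope.

Section Graph.
Context {V : choiceType} (adj : rel V).

Definition nbrs (x : V) : set V := [set y | adj x y].

Definition deg (x : V) : nat := #|` fset_set (nbrs x)|.

Definition locally_finite_graph : Prop := forall x, finite_set (nbrs x).

Definition simple_graph : Prop := symmetric adj /\ irreflexive adj.

Definition has_walk (x y : V) (n : nat) : Prop :=
  exists p : seq V, [/\ path adj x p, last x p = y & size p = n].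

Definition connected_graph : Prop := forall x y, exists n, has_walk x y n.

Definition bipartite_graph : Prop :=
  exists A : set V, forall x y, adj x y -> (A x <-> ~ A y).

(* Meaningful only when some walk joins [x] to [y]; the value is 0 otherwise. *)
Definition gdist (x y : V) : nat :=
  xget 0%N [set n | has_walk x y n /\ forall m, has_walk x y m -> (n <= m)%N].

Definition gball (x : V) (r : nat) : set V := [set y | (gdist x y <= r)%N].

End Graph.

Section RandomWalk.
Context {R : realType} {V : choiceType} (adj : rel V).

(* Conditioning on the first step, which is uniform among the neighbours. *)
Fixpoint srw_prob (t : nat) (x y : V) : R :=
  if t is s.+1
  then \sum_(z \in nbrs adj x) (deg adj x)%:R^-1 * srw_prob s z y
  else (x == y)%:R.

End RandomWalk.

Section HilbertSpace.
Context {R : realType} {V : choiceType} (adj : rel V).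
Local Notation C := R[i].
Implicit Types (f g : V -> C) (T : (V -> C) -> V -> C).

(* Unordered sums; meaningful for absolutely summable families. *)
Definition rsum (a : V -> R) : R :=
  fine (\esum_(y in [set: V]) (EFin \o a)^\+%E y) -
  fine (\esum_(y in [set: V]) (EFin \o a)^\-%E y).

Definition csum (a : V -> C) : C :=
  rsum (fun y => complex.Re (a y)) +i* rsum (fun y => complex.Im (a y)).

Definition l2 f : Prop :=
  (\esum_(y in [set: V]) ((deg adj y)%:R * Normc.normc (f y) ^+ 2)%:E < +oo)%E.

Definition inner f g : C := csum (fun y => (deg adj y)%:R * f y * (g y)^*).

Definition l2norm f : R := Num.sqrt (complex.Re (inner f f)).

Definition transition f : V -> C :=
  fun x => (deg adj x)%:R^-1 * \sum_(y \in nbrs adj x) f y.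

Definition laplacian f : V -> C := f - transition f.

Definition signless_laplacian f : V -> C := f + transition f.

Definition unit_vector (x : V) : V -> C :=
  fun y => ((y == x)%:R / Num.sqrt (deg adj x)%:R)%:C.

(* Operators on l2 are represented by maps on all functions, of which only the
   restriction to l2 is relevant. Boundedness is automatic. *)
Definition orthogonal_projection T : Prop :=
  [/\ forall f, l2 f -> l2 (T f),
      forall (a : C) f g, l2 f -> l2 g -> T (a *: f + g) = a *: T f + T g,
      forall f, l2 f -> T (T f) = T f &
      forall f g, l2 f -> l2 g -> inner (T f) g = inner f (T g)].

Implicit Types (E : set (measurableTypeR R) -> (V -> C) -> V -> C).

(* Projection-valued measure on the Borel sets of the line; countable
   additivity is in the strong operator topology. *)
Definition resolution_of_identity E : Prop :=
  [/\ forall A, measurable A -> orthogonal_projection (E A),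
      forall f, l2 f -> E set0 f = 0,
      forall f, l2 f -> E setT f = f,
      forall A B f, measurable A -> measurable B -> l2 f ->
        E (A `&` B) f = E A (E B f) &
      forall (F : nat -> set (measurableTypeR R)) f,
        (forall n, measurable (F n)) -> trivIset setT F -> l2 f ->
        l2norm (E (\bigcup_n F n) f - \sum_(k < n) E (F k) f)
          @[n --> \oo] --> (0 : R)].

(* [E] is the resolution of identity of the bounded self-adjoint operator [T]:
   T is the integral of l dE(l), i.e. <T f, f> is the integral of l against
   the measure <E(.) f, f>, for all f. The scalars being
   complex, polarization then gives <T f, g> for all f and g. *)
Definition spectral_resolution T E : Prop :=
  resolution_of_identity E /\
  forall f, l2 f ->
    exists mu : {measure set (measurableTypeR R) -> \bar R},
      [/\ forall A, measurable A -> mu A = (complex.Re (inner (E A f) f))%:E,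
          mu.-integrable setT (fun l => (l : R)%:E) &
          inner (T f) f = (\int[mu]_(l in setT) (l : R))%:C].

(* [E] stands for the resolution of identity of [laplacian] in [mu_star], and of
   [signless_laplacian] in [mu_Q]. The values are complex numbers that happen to
   be real. *)
Definition mu_star E (x : V) (delta : R) : C :=
  inner (E `]0, delta]%classic (unit_vector x)) (unit_vector x).

Definition mu_Q E (x : V) (delta : R) : C :=
  inner (E `[0, delta]%classic (unit_vector x)) (unit_vector x).

End HilbertSpace.

Definition Gamma {R : realType} (s : R) : R :=
  \int[@lebesgue_measure R]_(u in `]0%R, +oo[) (u `^ (s - 1) * expR (- u)).

(* Main.v *)
(* Let $f = I(A) e_x$ be a spectral projection of $e_x$, with $A \subseteq [0,\delta]$,
   and let $M = \|f\|^2$. Then $M = \langle f, e_x \rangle = f(x) \sqrt{d(x)}$, while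
   the energy $\langle (I \mp P) f, f \rangle$ is at most $\delta M$. By
   Cauchy-Schwarz along a shortest path, $||f(x)| - |f(y)||^2 \le r \delta M$ when
   $\mathrm{dist}(x,y) \le r$, so $|f|$ is comparable to $M / \sqrt{d(x)}$ on a ball of
   radius about $M / (d(x) \delta)$. The volume growth of that ball, together with
   $\sum_y d(y) |f(y)|^2 \le M$, bounds $M$.

   The return probability at time $t$ only involves the $t$-neighbourhood of $x$,
   hence the finite symmetric matrix $1_{i \sim j} / \sqrt{d_i d_j}$; its spectral
   projections, extended by zero, satisfy the same bound. Then
   $|\lambda|^t \le e^{-t (1 - |\lambda|)}$ and the comparison of the spectral measure
   with the density proportional to $u^{a-1}$, where $a = D / (D + 1)$, produce the
   Gamma function. *)

Require Import Defs.
From mathcomp Require Import all_boot all_order all_algebra finmap.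
From mathcomp Require Import all_classical all_reals all_analysis.
From mathcomp Require Import complex.
From mathcomp Require Import measurable_realfun ring lra spectral.

Set Implicit Arguments.
Unset Strict Implicit.
Unset Printing Implicit Defensive.

Import Order.TTheory GRing.Theory Num.Theory.
Import numFieldNormedType.Exports.

Local Open Scope classical_set_scope.
Local Open Scope complex_scope.
Local Open Scope ring_scope.

(** * Laplace sums and the Gamma integral *)

Section GammaIntegral.
Context {R : realType}.
Local Notation mu := (@lebesgue_measure R).

Lemma measurable_gamma_integrand (a : R) (A : set R) :
  measurable_fun A (fun u : R => u `^ (a - 1) * expR (- u)).
Proof.
apply: (@measurable_funS _ _ _ _ setT) => //.
apply: measurable_funM; first exact: measurable_powR.
by apply: measurableT_comp => //; exact: measurable_expR.
Qed.

Lemma integral_powR_pos (a u v : R) : 0 < a -> 0 < u -> u < v ->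
  (\int[mu]_(x in `[u, v]) (x `^ (a - 1))%:E = ((v `^ a - u `^ a) / a)%:E)%E.
Proof.
move=> a0 u0 uv.
have dF (x : R) : 0 < x -> is_derive x 1 (fun x : R => x `^ a / a) (x `^ (a - 1)).
  move=> x0.
  have H := is_derive1_powR a x0.
  apply: is_derive_eq.
  by rewrite scaler0 add0r /GRing.scale /= mulrA mulVf ?mul1r// gt_eqF.
have cF (b x : R) : 0 < x -> {for x, continuous (fun x : R => x `^ b)}.
  move=> x0; apply/differentiable_continuous/derivable1_diffP.
  by apply: derivable_powR; rewrite in_itv/= x0.
rewrite (@continuous_FTC2 _ _ (fun x => x `^ a / a))//.
- by rewrite -EFinB mulrBl.
- apply: continuous_in_subspaceT => x; rewrite inE/= in_itv/= => /andP[ux _].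
  by apply: cF; exact: lt_le_trans ux.
- have cG (x : R) : 0 < x -> {for x, continuous (fun x : R => x `^ a / a)}.
    by move=> x0; have [/derivable1_diffP/differentiable_continuous] := dF _ x0.
  split.
  + move=> x; rewrite in_itv/= => /andP[ux _].
    by have [] := dF x (lt_trans u0 ux).
  + by apply: cvg_at_right_filter; apply: cG.
  + by apply: cvg_at_left_filter; apply: cG; exact: lt_trans uv.
- move=> x; rewrite in_itv/= => /andP[ux _].
  by rewrite derive1E; have [_ ->] := dF x (lt_trans u0 ux).
Qed.

(** For $a < 1$ the integrand is singular at $0$, so $]0, v]$ is exhausted by the intervals
    $[v/(n+2), v]$, where the fundamental theorem of calculus applies, and monotone convergence
    gives the limit. *)
Lemma integral_powR_itv0 (a v : R) : 0 < a -> 0 <= v ->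
  (\int[mu]_(x in `]0%R, v]) (x `^ (a - 1))%:E = (v `^ a / a)%:E)%E.
Proof.
move=> a0; rewrite le_eqVlt => /predU1P[<-|v0].
  by rewrite set_itvoc0 integral_set0 powR0 ?gt_eqF// mul0r.
pose F (n : nat) : set R := `[(v / n.+2%:R)%R, v]%classic.
have vn n : 0 < v / n.+2%:R :> R by rewrite divr_gt0.
have -> : `]0%R, v]%classic = \bigcup_n F n.
  apply/seteqP; split=> x /=.
  - rewrite in_itv/= => /andP[x0 xv].
    exists (Num.bound (v / x)) => //; rewrite /F/= in_itv/= xv andbT.
    rewrite ler_pdivrMr// mulrC -ler_pdivrMr//.
    have /ltW/le_trans -> // : v / x < (Num.bound (v / x))%:R.
      by apply: archi_boundP; rewrite divr_ge0 ?ltW.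
    by rewrite ler_nat ltnW.
  - move=> [n _]; rewrite /F/= !in_itv/= => /andP[vx ->].
    by rewrite andbT (lt_le_trans _ vx).
have H : (\int[mu]_(x in F i) (x `^ (a - 1))%:E @[i --> \oo] -->
    \int[mu]_(x in \bigcup_i F i) (x `^ (a - 1))%:E)%E.
  apply: ge0_nondecreasing_set_cvg_integral.
  - move=> m n mn; rewrite subsetEset /F => x/=; rewrite !in_itv/= => /andP[+ ->].
    rewrite andbT; apply: le_trans.
    by rewrite ler_pM2l// lef_pV2 ?posrE// ler_nat.
  - by move=> i; exact: measurable_itv.
  - by move=> i; apply/measurable_EFinP; exact: measurable_funS (measurable_powR _).
  - by move=> i x _; rewrite lee_fin powR_ge0.
apply: (cvg_unique _ H); first exact: ereal_hausdorff.
have -> : (fun i => \int[mu]_(x in F i) (x `^ (a - 1))%:E)%E =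
          EFin \o (fun i : nat => (v `^ a - (v / i.+2%:R) `^ a) / a).
  apply/funext => n; rewrite integral_powR_pos//.
  by rewrite ltr_pdivrMr// ltr_pMr// ltr1n.
apply: cvg_EFin; first exact: nearW.
rewrite [X in _ --> X](_ : _ = (v `^ a - 0) / a); last by rewrite subr0.
apply: cvgMl; apply: cvgB; first exact: cvg_cst.
have /cvg_at_rightP/(_ (fun n => v / n.+2%:R)) := powR_cvg0 a0; apply; split=> //.
rewrite -[X in _ --> X](mulr0 v); apply: cvgMr.
have := @cvg_harmonic R; rewrite -cvg_shiftS.
exact.
Qed.

Lemma gamma_integrand_ge0 (a u : R) : 0 <= u `^ (a - 1) * expR (- u).
Proof. by rewrite mulr_ge0 ?powR_ge0 ?expR_ge0. Qed.

(** The domain is cut at $1$: below it the integrand is at most $u^{a-1}$, above it at most the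
    exponential density, since $u^{a-1} \le 1$ for $a \le 1$. *)
Lemma gamma_integral_fin_num (a : R) (A : set R) : 0 < a <= 1 ->
  measurable A -> A `<=` `]0, +oo[ ->
  (\int[mu]_(u in A) (u `^ (a - 1) * expR (- u))%:E)%E \is a fin_num.
Proof.
move=> /andP[a0 a1] mA A0.
rewrite ge0_fin_numE; last first.
  by apply: integral_ge0 => u _; rewrite lee_fin gamma_integrand_ge0.
have mg B := (measurable_EFinP _ _).2 (@measurable_gamma_integrand a B).
have g0 (B : set R) u : B u -> (0 <= (u `^ (a - 1) * expR (- u))%:E)%E.
  by move=> _; rewrite lee_fin gamma_integrand_ge0.
apply: le_lt_trans (ge0_subset_integral mu mA (measurable_itv _) (mg _) (g0 _) A0) _.
have -> : `]0%R, +oo[%classic = `]0%R, 1] `|` `]1, +oo[ :> set R.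
  by rewrite -itv_bndbnd_setU ?bnd_simp.
rewrite ge0_integral_setU//; last 3 first.
- exact: mg.
- exact: g0.
- rewrite disj_set2E; apply/eqP/seteqP; split=> // u [] /=.
  by rewrite !in_itv/= => /andP[_ /le_lt_trans u1] /andP[/u1]; rewrite ltxx.
apply: lte_add_pinfty.
- apply: (@le_lt_trans _ _ (\int[mu]_(u in `]0%R, 1%R]) (u `^ (a - 1))%:E)%E).
    apply: ge0_le_integral => //.
    + exact: g0.
    + exact: mg.
    + by apply/measurable_EFinP; exact: measurable_funS (measurable_powR _).
    + move=> u; rewrite /= in_itv/= => /andP[u0 _].
      by rewrite lee_fin ler_piMr ?powR_ge0// -expR0 ler_expR oppr_le0 ltW.
  by rewrite integral_powR_itv0// ltry.
- apply: (@le_lt_trans _ _ (\int[mu]_(u in `]1%R, +oo[) (exponential_pdf 1 u)%:E)%E).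
    apply: ge0_le_integral => //.
    + exact: g0.
    + exact: mg.
    + by apply/measurable_EFinP; exact: measurable_funS (measurable_exponential_pdf _).
    + move=> u; rewrite /= in_itv/= andbT => u1.
      have u0 : 0 <= u by rewrite (le_trans _ (ltW u1)).
      rewrite lee_fin /exponential_pdf patchE mem_set; last first.
        by rewrite /= in_itv/= andbT.
      rewrite mul1r mulN1r ler_piMl ?expR_ge0// -[leRHS](powRr0 u).
      by apply: ler_powR; rewrite ?subr_le0// ltW.
  apply: le_lt_trans (_ : (1 < +oo)%E); last exact: ltry.
  rewrite -(integral_exponential_pdf (@ltr01 R)).
  apply: ge0_subset_integral => //.
  + by apply/measurable_EFinP; exact: measurable_exponential_pdf.
  + by move=> x _; rewrite lee_fin exponential_pdf_ge0.
Qed.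
End GammaIntegral.

(** * Laplace transforms of atomic measures with a power bound on their distribution function *)

Section LaplaceSum.
Context {R : realType}.
Local Notation mu := (@lebesgue_measure R).

Let lower_gamma (a v : R) : R :=
  \int[mu]_(u in `]0%R, v]) (u `^ (a - 1) * expR (- u)).

Let lower_gamma_ge0 (a v : R) : 0 <= lower_gamma a v.
Proof. by apply: Rintegral_ge0 => u _; rewrite gamma_integrand_ge0. Qed.

Let lower_gamma_le (a v : R) : 0 < a <= 1 -> lower_gamma a v <= Gamma a.
Proof.
move=> a01; apply: fine_le.
- apply: gamma_integral_fin_num => // u /=.
  by rewrite !in_itv/= => /andP[->].
- exact: gamma_integral_fin_num.
apply: ge0_subset_integral => //.
- by apply/measurable_EFinP; exact: measurable_gamma_integrand.
- by move=> u _; rewrite lee_fin gamma_integrand_ge0.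
- by move=> u /=; rewrite !in_itv/= => /andP[->].
Qed.

(** On $]u, v]$ the factor $e^{-x}$ is at least $e^{-v}$, and $x^{a-1}$ integrates to $(v^a -
    u^a)/a$. *)
Let lower_gamma_increment (a u v : R) : 0 < a <= 1 -> 0 <= u <= v ->
  (v `^ a - u `^ a) * expR (- v) <= a * (lower_gamma a v - lower_gamma a u).
Proof.
move=> a01 /andP[u0 uv].
have /andP[a0 a1] := a01.
have sub (w z : R) : 0 <= w -> `]w, z]%classic `<=` `]0, +oo[%classic.
  by move=> w0 y /=; rewrite !in_itv/= => /andP[/(le_lt_trans w0) ->].
have split (f : R -> R) : (forall x, 0 <= f x) -> measurable_fun setT f ->
    (\int[mu]_(x in `]0%R, v]) (f x)%:E = \int[mu]_(x in `]0%R, u]) (f x)%:E +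
     \int[mu]_(x in `]u, v]) (f x)%:E)%E.
  move=> f0 mf.
  have -> : `]0%R, v]%classic = `]0%R, u] `|` `]u, v] :> set R.
    by rewrite -itv_bndbnd_setU ?bnd_simp.
  rewrite ge0_integral_setU//.
  - by apply/measurable_EFinP; exact: measurable_funS mf.
  - by move=> x _; rewrite lee_fin.
  - rewrite disj_set2E; apply/eqP/seteqP; split=> // x [] /=.
    by rewrite !in_itv/= => /andP[_ /le_lt_trans xu] /andP[/xu]; rewrite ltxx.
have fin := gamma_integral_fin_num a01 (measurable_itv _).
have -> : lower_gamma a v - lower_gamma a u =
    \int[mu]_(x in `]u, v]) (x `^ (a - 1) * expR (- x)).
  rewrite /lower_gamma /Rintegral (split (fun x => x `^ (a - 1) * expR (- x)))//.
  - by rewrite fineD; [rewrite addrC addKr|exact/fin/sub|exact/fin/sub].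
  - by move=> x; exact: gamma_integrand_ge0.
  - exact: measurable_gamma_integrand.
have pow_uv :
    (\int[mu]_(x in `]u, v]) (x `^ (a - 1))%:E = ((v `^ a - u `^ a) / a)%:E)%E.
  have := split (fun x => x `^ (a - 1)) (fun x => powR_ge0 _ _) (measurable_powR _).
  rewrite !integral_powR_itv0//; last exact: le_trans uv.
  move=> H; rewrite mulrBl EFinB H addeAC subee ?add0e//.
have exp_le : ((expR (- v))%:E * \int[mu]_(x in `]u, v]) (x `^ (a - 1))%:E <=
    \int[mu]_(x in `]u, v]) (x `^ (a - 1) * expR (- x))%:E)%E.
  rewrite -ge0_integralZl_EFin ?expR_ge0//.
  - apply: ge0_le_integral => //.
    + by move=> x _; rewrite -EFinM lee_fin mulr_ge0 ?expR_ge0 ?powR_ge0.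
    + apply: measurable_funeM; apply/measurable_EFinP.
      exact: measurable_funS (measurable_powR _).
    + by apply/measurable_EFinP; exact: measurable_gamma_integrand.
    + move=> x; rewrite /= in_itv/= => /andP[_ xv].
      by rewrite -EFinM lee_fin mulrC ler_wpM2l ?powR_ge0// ler_expR lerN2.
  - by move=> x _; rewrite lee_fin powR_ge0.
  - by apply/measurable_EFinP; exact: measurable_funS (measurable_powR _).
rewrite pow_uv -EFinM in exp_le.
rewrite -ler_pdivrMl// /Rintegral -lee_fin fineK; last exact/fin/sub.
by apply: le_trans exp_le; rewrite lee_fin mulrC mulrAC mulrC.
Qed.

(** Mass transport, by induction from the smallest [nu] to the largest. Atoms of total mass $W$ are
    matched with the part of the measure $K a u^{a-1} du$ on $]0, (W/K)^{1/a}]$, which has the same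
    mass. Each further atom takes the next interval $]u, v]$, and the distribution bound places $v$
    at or below the atom, where $e^{-u}$ is not smaller. *)
Let laplace_sum_sorted (I : eqType) (s : seq I) (w nu : I -> R) (a K : R) :
  0 < a <= 1 -> 0 < K -> (forall i, 0 <= w i) ->
  (forall r, 0 < r -> \sum_(i <- s | nu i <= r) w i <= K * r `^ a) ->
  sorted (fun i j => nu j <= nu i) s ->
  \sum_(i <- s) w i * expR (- nu i) <=
    K * a * lower_gamma a (((\sum_(i <- s) w i) / K) `^ a^-1).
Proof.
move=> a01 K0 w0; have /andP[a0 a1] := a01.
elim: s => [|i s IH] bound sorted_s.
  by rewrite !big_nil !mulr_ge0// ltW.
have W0 : 0 <= \sum_(j <- s) w j by apply: sumr_ge0.
have {}IH : \sum_(i <- s) w i * expR (- nu i) <=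
    K * a * lower_gamma a (((\sum_(i <- s) w i) / K) `^ a^-1).
  apply: IH => [r r0|]; last exact: path_sorted sorted_s.
  apply: le_trans (bound _ r0).
  by rewrite big_cons; case: ifP => // _; rewrite lerDr.
have last_i : all (fun j => nu j <= nu i) s.
  apply: order_path_min sorted_s => x y z yx zy; exact: le_trans yx.
rewrite !big_cons.
set W := \sum_(j <- s) w j in W0 IH *.
set u := (W / K) `^ a^-1 in IH *; set v := ((w i + W) / K) `^ a^-1.
have powK (x : R) : 0 <= x -> (x `^ a^-1) `^ a = x.
  by move=> x0; rewrite -powRrM mulVf ?gt_eqF// powRr1.
have uv : 0 <= u <= v.
  rewrite powR_ge0 /=; apply: ge0_ler_powR.
  - by rewrite invr_ge0 ltW.
  - by rewrite nnegrE divr_ge0// ltW.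
  - by rewrite nnegrE divr_ge0 ?addr_ge0// ltW.
  - by rewrite ler_pM2r ?invr_gt0// lerDr.
have incr := lower_gamma_increment a01 uv.
have powu : u `^ a = W / K by rewrite powK// divr_ge0// ltW.
have powv : v `^ a = (w i + W) / K by rewrite powK// divr_ge0 ?addr_ge0// ltW.
rewrite powu powv -mulrBl addrK in incr.
(* The head has the largest [nu], so for $r \ge \nu_i$ the bound controls the whole mass. At $r =
   \nu_i > 0$ this says exactly $v \le \nu_i$. *)
have total r : nu i <= r -> 0 < r -> w i + W <= K * r `^ a.
  move=> ir r0; apply: le_trans (bound _ r0).
  rewrite big_cons ir lerD2l /W big_seq [leRHS]big_seq_cond.
  rewrite le_eqVlt; apply/orP; left; apply/eqP; apply: eq_bigl => j.
  by case: (boolP (j \in s)) => //= /(allP last_i)/le_trans ->.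
suff : w i * expR (- nu i) <= K * (w i / K * expR (- v)).
  move=> H; apply: le_trans (lerD H IH) _.
  by rewrite -lerBrDr -mulrBr -[leRHS]mulrA ler_pM2l.
rewrite mulrA mulrCA divff ?gt_eqF// mulr1.
have [nu0|nu0] := leP (nu i) 0; last first.
  apply: ler_wpM2l => //; rewrite ler_expR lerN2.
  rewrite -[leRHS](_ : ((nu i) `^ a) `^ a^-1 = _); last first.
    by rewrite -powRrM mulfV ?gt_eqF// powRr1// ltW.
  apply: ge0_ler_powR.
  - by rewrite invr_ge0 ltW.
  - by rewrite nnegrE divr_ge0 ?addr_ge0// ltW.
  - by rewrite nnegrE powR_ge0.
  - by rewrite ler_pdivrMr// mulrC total.
(* If $\nu_i \le 0$, the whole mass is at most $K r^a$ for every $r > 0$. The radius [r0] below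
   makes $K r^a$ half of that mass, which is absurd unless it vanishes. *)
suff -> : w i = 0 by rewrite !mul0r.
apply/eqP; rewrite eq_le w0 andbT leNgt; apply/negP => wi0.
have wW : 0 < w i + W by rewrite ltr_pwDl.
have r0 : 0 < ((w i + W) / K / 2) `^ a^-1 by rewrite powR_gt0// !divr_gt0.
have := total _ (le_trans nu0 (ltW r0)) r0.
rewrite powK; last by rewrite !divr_ge0// ltW.
have -> : K * ((w i + W) / K / 2) = (w i + W) / 2.
  by field; rewrite gt_eqF.
by rewrite ler_pdivlMr// ger_pMr// leNgt ltr1n.
Qed.

(* Comparison of the atomic measure $\sum_i w_i \delta_{\nu_i}$ with the measure
   $K a u^{a-1} du$, whose distribution function $K r^a$ dominates it. *)
Lemma laplace_sum_le (I : eqType) (s : seq I) (w nu : I -> R) (a K : R) :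
  0 < a <= 1 -> 0 < K -> (forall i, 0 <= w i) ->
  (forall r, 0 < r -> \sum_(i <- s | nu i <= r) w i <= K * r `^ a) ->
  \sum_(i <- s) w i * expR (- nu i) <= K * a * Gamma a.
Proof.
move=> a01 K0 w0 bound; have /andP[a0 _] := a01.
have E := permEl (perm_sort (fun i j => nu j <= nu i) s).
rewrite -(perm_big _ E)/=.
apply: le_trans (laplace_sum_sorted a01 K0 w0 _ (sort_sorted _ _)) _.
- by move=> r r0; rewrite (perm_big _ E)/= bound.
- by move=> i j; exact: le_total.
- by rewrite ler_wpM2l ?lower_gamma_le// mulr_ge0// ltW.
Qed.

End LaplaceSum.

(** * Mass of a localized function *)

(** With $s = D/(D+1)$ the hypothesis reads $c\, s^{2D} (1-s)^2 m^{D+1} \le \delta^D$. Both sides of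
    the conclusion are compared after raising them to the power $D+1$. *)
Lemma powR_optimal_radius_le {R : realType} (c D m delta : R) :
  0 < c -> 0 < D -> 0 < m -> 0 < delta ->
  c * ((D / (D + 1)) ^+ 2 * m / delta) `^ D * (1 - D / (D + 1)) ^+ 2 * m <= 1 ->
  m <= (D + 1) ^+ 2 / (c `^ (1 / (D + 1)) * D `^ (2 * D / (D + 1)))
       * delta `^ (D / (D + 1)).
Proof.
move=> c0 D0 m0 d0 H.
have D1 : 0 < D + 1 by rewrite addr_gt0.
have Dn : D + 1 != 0 by rewrite gt_eqF.
rewrite mulrAC ler_pdivlMr ?mulr_gt0 ?powR_gt0//.
set P := c `^ _; set Q := D `^ _; set S := delta `^ _.
have powK (x e : R) : (x `^ (e / (D + 1))) `^ (D + 1) = x `^ e.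
  by rewrite -powRrM divfK.
rewrite leNgt; apply/negP => lt_mPQ.
have : ((D + 1) ^+ 2 * S) `^ (D + 1) < (m * (P * Q)) `^ (D + 1).
  apply: gt0_ltr_powR => //; rewrite nnegrE.
  - by rewrite mulr_ge0 ?powR_ge0 ?exprn_ge0// ltW.
  - by rewrite !mulr_ge0 ?powR_ge0// ltW.
apply/negP; rewrite -leNgt.
have [E EE] : {E | E = (D + 1) ^+ 2} by exists ((D + 1) ^+ 2).
have D20 : 0 <= E by rewrite EE sqr_ge0.
rewrite -EE.
rewrite (powRM _ D20) ?powR_ge0// !powRM ?mulr_ge0 ?powR_ge0 ?(ltW m0)//.
rewrite /P /Q /S !powK powRr1 ?(ltW c0)//.
rewrite !powRD ?(negbTE Dn)//= !powRr1 ?(ltW m0)// EE.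
have -> : D `^ (2 * D) = (D ^+ 2) `^ D by rewrite powRrM -powR_mulrn ?ltW.
have -> : (m `^ D * m) * (c * (D ^+ 2) `^ D) =
    (c * ((D / (D + 1)) ^+ 2 * m / delta) `^ D * (1 - D / (D + 1)) ^+ 2 * m)
    * (((D + 1) ^+ 2) `^ D * delta `^ D * (D + 1) ^+ 2).
  have -> : (D ^+ 2) = (D / (D + 1)) ^+ 2 * (D + 1) ^+ 2 by field.
  have -> : (1 - D / (D + 1)) ^+ 2 = ((D + 1) ^+ 2)^-1 by field.
  rewrite [in LHS]powRM ?sqr_ge0//.
  have -> : m `^ D = (m / delta) `^ D * delta `^ D.
    by rewrite -powRM ?divfK ?gt_eqF ?divr_ge0// ltW.
  rewrite -[_ ^+ 2 * m / delta]mulrA [in RHS]powRM ?sqr_ge0 ?divr_ge0 ?(ltW m0) ?(ltW d0)//.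
  by field.
rewrite [leRHS](_ : _ = 1 * (((D + 1) ^+ 2) `^ D * delta `^ D * (D + 1) ^+ 2)).
  by apply: ler_wpM2r H; rewrite !mulr_ge0 ?powR_ge0 ?(ltW D1).
by rewrite mul1r mulrAC.
Qed.

Section SpectralMass.
Context {R : realType} {V : choiceType} (adj : rel V).

(* If $F$ stays close to $F x$ on a ball of radius $r$, then the growth of that
   ball bounds $M$; $s = D / (D + 1)$ is the fraction of $F x$ that optimizes
   the radius. *)
Lemma spectral_mass_le (x : V) (c D : R) (F : V -> R) (M delta : R) :
  0 < c -> 1 <= D -> (0 < deg adj x)%N ->
  (forall r : nat,
    c * (r%:R + 1) `^ D <= \sum_(y \in gball adj x r) ((deg adj y)%:R : R)) ->
  0 < delta ->
  (forall s : seq V, uniq s -> \sum_(y <- s) (deg adj y)%:R * F y ^+ 2 <= M) ->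
  (forall (r : nat) y, gball adj x r y ->
    (F x - F y) ^+ 2 <= r%:R * (delta * M)) ->
  M / Num.sqrt (deg adj x)%:R <= F x ->
  M <= (D + 1) ^+ 2 / (c `^ (1 / (D + 1)) * D `^ (2 * D / (D + 1)))
       * (deg adj x)%:R * delta `^ (D / (D + 1)).
Proof.
move=> c0 D1 dx0 growth d0 norm_le energy_le Fx_ge.
have D0 : 0 < D by exact: lt_le_trans D1.
have M0 : 0 <= M by rewrite (le_trans _ (norm_le [::] _))// big_nil.
move: M0; rewrite le_eqVlt => /predU1P[<-|M0].
  by rewrite !mulr_ge0 ?powR_ge0 ?invr_ge0 ?mulr_ge0 ?powR_ge0 ?addr_ge0 ?(ltW D0).
have dR : 0 < (deg adj x)%:R :> R by rewrite ltr0n.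
set dx := (deg adj x)%:R in dR Fx_ge *.
pose m := M / dx.
have m0 : 0 < m by rewrite divr_gt0.
rewrite mulrAC -ler_pdivrMr//; apply: powR_optimal_radius_le => //.
set s := D / (D + 1).
have s0 : 0 < s by rewrite divr_gt0// addr_gt0.
have s1 : s < 1 by rewrite ltr_pdivrMr ?addr_gt0// mul1r ltrDl.
clearbody s.
(* The radius at which the oscillation bound $A \delta M$ equals the square of $s M / \sqrt{d(x)}$,
   so that $F$ keeps at least the fraction $1 - s$ of $M / \sqrt{d(x)}$. *)
pose A := s ^+ 2 * m / delta.
have A0 : 0 < A by rewrite divr_gt0// mulr_gt0// exprn_gt0.
(* Rounding down is right on both counts: $r \le A$ serves the oscillation bound, and $A < r + 1$
   matches the $(r+1)^D$ of the growth hypothesis. *)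
pose r := Num.truncn A.
have /andP[rA Ar] : r%:R <= A < r.+1%:R by apply: truncn_itv; exact: ltW.
have sq_dx : Num.sqrt dx ^+ 2 = dx by rewrite sqr_sqrtr// ltW.
have sq0 : 0 < Num.sqrt dx by rewrite sqrtr_gt0.
have F_ball y : gball adj x r y -> (1 - s) ^+ 2 * m * M <= F y ^+ 2.
  move=> /energy_le Hy.
  have Hs : (F x - F y) ^+ 2 <= (s * (M / Num.sqrt dx)) ^+ 2.
    apply: le_trans Hy _.
    apply: le_trans (_ : A * (delta * M) <= _).
      by rewrite ler_wpM2r// mulr_ge0// ltW.
    rewrite exprMn expr_div_n sq_dx /A /m le_eqVlt; apply/orP; left; apply/eqP.
    by field; rewrite !gt_eqF.
  have K0 : 0 <= s * (M / Num.sqrt dx) by rewrite ltW// mulr_gt0// divr_gt0.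
  have Hs' : F x - F y <= s * (M / Num.sqrt dx).
    apply: le_trans (ler_norm _) _.
    rewrite -(@ler_pXn2r _ 2)// ?nnegrE ?normr_ge0 ?K0//.
    by rewrite real_normK ?num_real.
  have Fy : (1 - s) * (M / Num.sqrt dx) <= F y.
    rewrite mulrBl mul1r; lra.
  rewrite [leLHS](_ : _ = ((1 - s) * (M / Num.sqrt dx)) ^+ 2); last first.
    by rewrite exprMn expr_div_n sq_dx /m; field; rewrite gt_eqF.
  have K1 : 0 <= (1 - s) * (M / Num.sqrt dx).
    by rewrite ltW// mulr_gt0 ?subr_gt0// divr_gt0.
  by rewrite ler_pXn2r// nnegrE (le_trans K1 Fy).
have {}norm_le : c * A `^ D * ((1 - s) ^+ 2 * m * M) <= M.
  have := growth r.
  (* [t] lists the vertices that the sum over the ball really runs through. It is empty by default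
     if the support is infinite, so the inclusion in the ball holds in every case. *)
  set t := finite_support _ _ _ => grow.
  have tP y : y \in t -> gball adj x r y.
    rewrite /t; case: finite_supportP => [//|X XP _ _ yX].
    by apply: XP.
  apply: le_trans (norm_le t _); last exact: finite_support_uniq.
  apply: le_trans (_ : (\sum_(y <- t) (deg adj y)%:R) * ((1 - s) ^+ 2 * m * M) <= _).
    apply: ler_wpM2r.
      by rewrite ltW// mulr_gt0// mulr_gt0// exprn_gt0// subr_gt0.
    apply: le_trans grow; apply: ler_wpM2l; first exact: ltW.
    apply: ge0_ler_powR; rewrite ?nnegrE ?addr_ge0//; [exact: ltW|exact: ltW|].
    by rewrite natr1 ltW.
  rewrite mulr_suml big_seq [leRHS]big_seq; apply: ler_sum => y /tP yB.
  by rewrite ler_wpM2l// F_ball.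
rewrite -(ler_pM2r M0) mul1r.
apply: le_trans norm_le; rewrite le_eqVlt; apply/orP; left; apply/eqP.
by rewrite -/m -/A !mulrA.
Qed.

End SpectralMass.

(** * Energy of square-summable functions *)

Section Summation.
Context {R : realType} {V : choiceType}.
Implicit Types (a p q : V -> R) (s : seq V).

Lemma ler_sum_uniq_sub s t a : uniq s -> uniq t -> {subset s <= t} ->
  (forall y, 0 <= a y) -> \sum_(y <- s) a y <= \sum_(y <- t) a y.
Proof.
move=> us ut st a0.
have /(perm_big _) -> : perm_eq s [seq y <- t | y \in s].
  apply: uniq_perm => //; first exact: filter_uniq.
  by move=> y; rewrite mem_filter; case: (boolP (y \in s)) => // /st ->.
by rewrite big_filter [leRHS](bigID (mem s))/= lerDl sumr_ge0.
Qed.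

Lemma sum_le_esum s a : uniq s -> (forall y, 0 <= a y) ->
  ((\sum_(y <- s) a y)%:E <= \esum_(y in [set: V]) (a y)%:E)%E.
Proof.
move=> us a0; apply: esum_ge; exists [set` s].
  by split => //; exact: finite_seq.
by rewrite -fsbig_seq// sumEFin.
Qed.

Lemma esum_seq_support s a : uniq s -> (forall y, 0 <= a y) ->
  (forall y, y \notin s -> a y = 0) ->
  (\esum_(y in [set: V]) (a y)%:E = (\sum_(y <- s) a y)%:E)%E.
Proof.
move=> us a0 supp; rewrite -sumEFin fsbig_seq// -esum_fset.
- rewrite [RHS]esum_mkcond; apply: eq_esum => y _.
  case: ifPn => // ys; rewrite supp//.
  by apply: contra ys => ys; rewrite inE.
- exact: finite_seq.
- by move=> y _; rewrite lee_fin.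
Qed.

Lemma rsum_ge0 a : (forall y, 0 <= a y) ->
  rsum a = fine (\esum_(y in [set: V]) (a y)%:E).
Proof.
move=> a0; rewrite /rsum.
have -> : \esum_(y in [set: V]) (EFin \o a)^\-%E y = 0%E.
  apply: esum1 => y _; rewrite funenegE /= -EFin_max.
  by congr EFin; apply/max_idPr; rewrite oppr_le0.
rewrite subr0; congr fine; apply: eq_esum => y _.
by rewrite funeposE /= -EFin_max; congr EFin; apply/max_idPl.
Qed.

(** [rsum] is defined by positive and negative parts $P, N$; any other splitting into nonnegative
    summable families gives the same value, because $P \le p$ and $N \le q$ are summable and $P + q
    = p + N$. *)
Lemma rsum_diff a p q : (forall y, 0 <= p y) -> (forall y, 0 <= q y) ->
  (\esum_(y in [set: V]) (p y)%:E < +oo)%E ->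
  (\esum_(y in [set: V]) (q y)%:E < +oo)%E ->
  (forall y, a y = p y - q y) ->
  rsum a = fine (\esum_(y in [set: V]) (p y)%:E) -
           fine (\esum_(y in [set: V]) (q y)%:E).
Proof.
move=> p0 q0 fp fq aE.
pose P y : R := Num.max (a y) 0; pose N y : R := Num.max (- a y) 0.
have P0 y : 0 <= P y by rewrite le_max lexx orbT.
have N0 y : 0 <= N y by rewrite le_max lexx orbT.
have PN y : P y - N y = a y.
  rewrite /P /N; have [a0|] := boolP (0 <= a y); last rewrite -ltNge => a0.
    have a0' : - a y <= 0 by rewrite oppr_le0.
    by rewrite (max_idPl a0) (max_idPr a0') subr0.
  have a0' : 0 <= - a y by rewrite oppr_ge0 ltW.
  by rewrite (max_idPr (ltW a0)) (max_idPl a0') sub0r opprK.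
have fin_num (b c : V -> R) : (forall y, 0 <= b y) -> (forall y, b y <= c y) ->
    (\esum_(y in [set: V]) (c y)%:E < +oo)%E ->
    (\esum_(y in [set: V]) (b y)%:E)%E \is a fin_num.
  move=> b0 bc fc; rewrite ge0_fin_numE; last first.
    by apply: esum_ge0 => y _; rewrite lee_fin.
  by apply: le_lt_trans fc; apply: le_esum => y _; rewrite lee_fin.
have Pp y : P y <= p y by rewrite ge_max p0 aE lerBlDr lerDl q0.
have Nq y : N y <= q y by rewrite ge_max q0 aE opprB lerBlDr lerDl p0.
have -> : rsum a = fine (\esum_(y in [set: V]) (P y)%:E) -
    fine (\esum_(y in [set: V]) (N y)%:E).
  congr (fine _ - fine _); apply: eq_esum => y _.
    by rewrite funeposE /= -EFin_max.
  by rewrite funenegE /= -EFin_max.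
have FP := fin_num _ _ P0 Pp fp; have FN := fin_num _ _ N0 Nq fq.
have Fp := fin_num _ _ p0 (fun y => lexx _) fp.
have Fq := fin_num _ _ q0 (fun y => lexx _) fq.
apply/eqP; rewrite subr_eq addrAC eq_sym subr_eq; apply/eqP.
rewrite -!fineD//; congr fine; rewrite -!esumD; try by move=> y _; rewrite lee_fin.
apply: eq_esum => y _; rewrite -!EFinD; congr EFin.
have := PN y; rewrite aE => /eqP; rewrite subr_eq addrAC eq_sym subr_eq => /eqP.
by move=> <-; rewrite addrC.
Qed.

Lemma rsum_seq_support s a : uniq s -> (forall y, y \notin s -> a y = 0) ->
  rsum a = \sum_(y <- s) a y.
Proof.
move=> us supp.
have ltoo (b : V -> R) : (forall y, 0 <= b y) -> (forall y, y \notin s -> b y = 0) ->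
    (\esum_(y in [set: V]) (b y)%:E < +oo)%E.
  by move=> b0 bs; rewrite (esum_seq_support us b0 bs) ltry.
have n0 y : 0 <= `|a y| by [].
have supp_n y : y \notin s -> `|a y| = 0 by move=> /supp ->; rewrite normr0.
have m0 y : 0 <= `|a y| - a y by rewrite subr_ge0 ler_norm.
have supp_m y : y \notin s -> `|a y| - a y = 0 by move=> /supp ->; rewrite normr0 subr0.
rewrite (@rsum_diff a (fun y => `|a y|) (fun y => `|a y| - a y))//.
- rewrite !(esum_seq_support us)//= -sumrB; apply: eq_bigr => y _.
  by rewrite subKr.
- exact: ltoo.
- exact: ltoo.
- by move=> y; rewrite subKr.
Qed.

Lemma csum_seq_support s (a : V -> R[i]) : uniq s ->
  (forall y, y \notin s -> a y = 0) -> csum a = \sum_(y <- s) a y.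
Proof.
move=> us supp; rewrite /csum !(rsum_seq_support us).
- have sumE (F : V -> R[i]) : \sum_(y <- s) F y =
      (\sum_(y <- s) complex.Re (F y)) +i* (\sum_(y <- s) complex.Im (F y)).
    elim: s {us supp} => [|y s IH]; first by rewrite !big_nil.
    by rewrite !big_cons IH; case: (F y).
  by rewrite -sumE.
- by move=> y /supp ->.
- by move=> y /supp ->.
Qed.

Lemma Re_sum s (P : pred V) (F : V -> R[i]) :
  complex.Re (\sum_(y <- s | P y) F y) = \sum_(y <- s | P y) complex.Re (F y).
Proof.
elim: s => [|y s IH]; first by rewrite !big_nil.
by rewrite !big_cons -IH; case: ifP => // _; case: (F y); case: (\sum_(_ <- s | _) _).
Qed.

Lemma normc_sqr (z : R[i]) :
  Normc.normc z ^+ 2 = complex.Re z ^+ 2 + complex.Im z ^+ 2.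
Proof. by case: z => u v; rewrite /= sqr_sqrtr// addr_ge0 ?sqr_ge0. Qed.

Lemma Re_natrM n (z : R[i]) : complex.Re (n%:R * z) = n%:R * complex.Re z.
Proof.
have -> : n%:R = (n%:R : R)%:C :> R[i] by rewrite rmorph_nat.
by case: z => u v /=; rewrite mul0r subr0.
Qed.

End Summation.

(** * Dirichlet energy of the two Laplacians *)

Section Energy.
Context {R : realType} {V : choiceType} (adj : rel V).
Hypothesis adj_sym : symmetric adj.
Hypothesis adj_irr : irreflexive adj.
Hypothesis adj_fin : locally_finite_graph adj.
Local Notation C := R[i].
Implicit Types (f g : V -> C) (e : R).

Lemma mem_nbrs v z : (z \in fset_set (nbrs adj v)) = adj v z.
Proof. by rewrite in_fset_set//; apply/idP/idP; rewrite inE. Qed.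

Lemma transitionE f v : (0 < deg adj v)%N ->
  (deg adj v)%:R * transition adj f v = \sum_(z <- fset_set (nbrs adj v)) f z.
Proof.
move=> dv; rewrite /transition fsbig_finite//.
by rewrite mulVKf// pnatr_eq0 -lt0n.
Qed.

Lemma sum_nbrs_cst v (a : R) :
  \sum_(z <- fset_set (nbrs adj v)) a = (deg adj v)%:R * a.
Proof. by rewrite big_const_seq count_predT iter_addr_0 mulr_natl. Qed.

(* The sign $e$ is $1$ for [laplacian] and $-1$ for [signless_laplacian]. *)
Definition edge_energy e f v z : R := Normc.normc (f v - e%:C * f z) ^+ 2.

(** Each vertex is charged half of every incident edge, so that summing over the vertices counts
    each edge once. *)
Definition vertex_energy e f v : R :=
  (\sum_(z <- fset_set (nbrs adj v)) edge_energy e f v z) / 2.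

Lemma edge_energy_ge0 e f v z : 0 <= edge_energy e f v z.
Proof. exact: sqr_ge0. Qed.

Lemma vertex_energy_ge0 e f v : 0 <= vertex_energy e f v.
Proof. by rewrite divr_ge0// sumr_ge0// => z _; exact: edge_energy_ge0. Qed.

Lemma edge_energyE e f v z : e ^+ 2 = 1 ->
  edge_energy e f v z = Normc.normc (f v) ^+ 2 + Normc.normc (f z) ^+ 2
    - 2 * (e * complex.Re (f z * (f v)^*)).
Proof.
move=> e1; rewrite /edge_energy !normc_sqr.
case: (f v) (f z) => [a b] [c d] /=.
rewrite mul0r subr0 mul0r addr0.
rewrite [RHS](_ : _ = a ^+ 2 + b ^+ 2 + e ^+ 2 * (c ^+ 2 + d ^+ 2)
  - 2 * (e * (c * a + d * b))); first by ring.
by rewrite e1; ring.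
Qed.

Lemma edge_energyC e f v z : e ^+ 2 = 1 ->
  edge_energy e f v z = edge_energy e f z v.
Proof.
move=> e1; rewrite !edge_energyE//.
have -> : complex.Re (f z * (f v)^*) = complex.Re (f v * (f z)^*).
  by case: (f v) (f z) => [a b] [c d] /=; ring.
by rewrite [X in X - _]addrC.
Qed.

(* Absolute values erase the sign $e$, so that the two Laplacians are treated
   alike. *)
Lemma normc_diff_le_edge e f v z : e ^+ 2 = 1 ->
  (Normc.normc (f v) - Normc.normc (f z)) ^+ 2 <= edge_energy e f v z.
Proof.
move=> e1.
have ne : Normc.normc e%:C = 1 by rewrite /= expr0n addr0 e1 sqrtr1.
have n0 (w : C) : 0 <= Normc.normc w by case: w => a b; exact: sqrtr_ge0.
rewrite /edge_energy.
have normD (y z' : C) : Normc.normc (y + z') <= Normc.normc y + Normc.normc z'.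
  exact: le_normcD.
have normN (y : C) : Normc.normc (- y) = Normc.normc y.
  by case: y => a b; rewrite /= !sqrrN.
have := normD (f v - e%:C * f z) (e%:C * f z).
have := normD (e%:C * f z - f v) (f v).
rewrite !subrK Normc.normcM ne mul1r -[Normc.normc (_ - f v)]normN opprB.
move: (Normc.normc _) (Normc.normc _) (Normc.normc _) => a b W le1 le2.
nra.
Qed.

(** Cauchy-Schwarz along a path without repeated vertices, by induction on its length. The
    right-hand side is the energy of the subgraph induced on the path: the halved double sum counts
    each of its edges once. *)
Lemma path_energy_le e f v p : e ^+ 2 = 1 -> path adj v p -> uniq (v :: p) ->
  (Normc.normc (f v) - Normc.normc (f (last v p))) ^+ 2 <=
  (size p)%:R * (\sum_(u <- v :: p)
    (\sum_(z <- v :: p | adj u z) edge_energy e f u z) / 2).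
Proof.
move=> e1; elim: p v => [|y p IH] v.
  by rewrite /= subrr expr0n mul0r.
rewrite [path _ _ _]/= [uniq _]/= => /andP[vy yp] /andP[vyp uyp].
have {}IH := IH y yp uyp.
set s := y :: p in vyp uyp IH *.
pose Q (t : seq V) := \sum_(u <- t)
    (\sum_(z <- t | adj u z) edge_energy e f u z) / 2.
rewrite -/(Q _) in IH; rewrite -/(Q _).
have ee0 := edge_energy_ge0 e f.
(* The new edge is seen twice, once in the row of [v] and once in the row of [y]; the two halves add
   up to its full energy. *)
have Qv : Q s + edge_energy e f v y <= Q (v :: s).
  have half (u : V) (F : V -> R) : (forall z, 0 <= F z) -> adj u y ->
      F y <= \sum_(z <- s | adj u z) F z.
    by move=> F0 uy; rewrite big_cons uy lerDl sumr_ge0.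
  rewrite {2}/Q big_cons big_cons adj_irr.
  have -> : \sum_(u <- s) (\sum_(z <- v :: s | adj u z) edge_energy e f u z) / 2
     = Q s + (\sum_(u <- s | adj v u) edge_energy e f v u) / 2.
    rewrite /Q [X in _ = _ + X / 2]big_mkcond [in RHS]mulr_suml -big_split/=; apply: eq_bigr => u _.
    rewrite big_cons adj_sym; case: ifP => _; last by rewrite mul0r addr0.
    by rewrite mulrDl addrC (edge_energyC _ _ _ e1).
  have := half v (edge_energy e f v) (ee0 v) vy; lra.
have Q0 : 0 <= Q s.
  by apply: sumr_ge0 => u _; rewrite divr_ge0// sumr_ge0.
have wE := normc_diff_le_edge f v y e1.
rewrite [last _ _]/= [size _]/=.
set w := Normc.normc (f v) - Normc.normc (f y) in wE.
set X := Normc.normc (f y) - Normc.normc (f (last y p)) in IH.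
have -> : Normc.normc (f v) - Normc.normc (f (last y p)) = w + X.
  by rewrite /w /X addrA subrK.
have {}Qv : Q s + w ^+ 2 <= Q (v :: s) by apply: le_trans Qv; rewrite lerD2l.
apply: le_trans (_ : (size p).+1%:R * (Q s + w ^+ 2) <= _); last first.
  by rewrite ler_wpM2l.
move: IH; set q := Q s in Q0 *; move: (size p) => n; clear -Q0; move=> IH.
case: n IH => [|n] IH.
  have X0 : X = 0 by apply/eqP; rewrite -sqrf_eq0 eq_le sqr_ge0 andbT -(mul0r q).
  by rewrite X0 addr0 mul1r lerDr.
have n0 : 0 < n.+1%:R :> R by rewrite ltr0n.
rewrite -[n.+2]addn1 natrD; move: n.+1%:R n0 IH => m m0 IH.
rewrite -(ler_pM2l m0).
(* Since $X^2 \le m q$, the claim follows from $(m+1)(m w^2 + X^2) - m (w + X)^2 = (m w - X)^2$. *)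
have : 0 <= (m * w - X) ^+ 2 by exact: sqr_ge0.
nra.
Qed.

Hypothesis deg_gt0 : forall v, (0 < deg adj v)%N.

(** Both sides are sums over oriented edges, of the value at the head and at the tail respectively;
    reversing the edges exchanges them. *)
Lemma esum_nbrs (N : V -> R) : (forall v, 0 <= N v) ->
  (\esum_(v in [set: V]) (\sum_(z <- fset_set (nbrs adj v)) N z)%:E =
   \esum_(v in [set: V]) ((deg adj v)%:R * N v)%:E)%E.
Proof.
move=> N0.
have row (F : V -> R) v : (forall z, 0 <= F z) ->
    ((\sum_(z <- fset_set (nbrs adj v)) F z)%:E =
     \esum_(z in nbrs adj v) (F z)%:E)%E.
  move=> F0; rewrite esum_fset//; last by move=> z _; rewrite lee_fin.
  by rewrite fsbig_finite// sumEFin.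
under eq_esum do rewrite row//.
under [RHS]eq_esum do rewrite -sum_nbrs_cst row//.
rewrite !esum_esum; try by move=> *; rewrite lee_fin.
rewrite (@reindex_esum _ _ _ ([set: V] `*`` nbrs adj) ([set: V] `*`` nbrs adj)
  (fun k => (k.2, k.1)))//.
split=> [[u v] [_ /= uv]|[u v] [u' v'] _ _ /= [-> ->]//|[u v] [_ /= uv]].
  by split => //=; rewrite /nbrs/= adj_sym.
by exists (v, u) => //=; split => //=; rewrite /nbrs/= adj_sym.
Qed.

(** This holds for every [f]: when the sum diverges, both sides take the default value $0$. *)
Lemma inner_self f :
  inner adj f f = (fine (\esum_(v in [set: V])
    ((deg adj v)%:R * Normc.normc (f v) ^+ 2)%:E)%E)%:C.
Proof.
have ReE v : complex.Re ((deg adj v)%:R * f v * (f v)^*) =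
    (deg adj v)%:R * Normc.normc (f v) ^+ 2.
  rewrite -mulrA Re_natrM; congr (_ * _); rewrite normc_sqr.
  by case: (f v) => a b /=; ring.
have ImE v : complex.Im ((deg adj v)%:R * f v * (f v)^*) = 0.
  have -> : (deg adj v)%:R = ((deg adj v)%:R : R)%:C :> C by rewrite rmorph_nat.
  by case: (f v) => a b /=; ring.
rewrite /inner /csum; congr (_ +i* _).
  rewrite rsum_ge0; last first.
    by move=> v; rewrite ReE mulr_ge0// sqr_ge0.
  by congr fine; apply: eq_esum => v _; rewrite ReE.
rewrite (@rsum_seq_support _ _ [::]) ?big_nil// => v _; exact: ImE.
Qed.

Lemma vertex_energy_le e f v : e ^+ 2 = 1 ->
  vertex_energy e f v <= (deg adj v)%:R * Normc.normc (f v) ^+ 2 +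
    \sum_(z <- fset_set (nbrs adj v)) Normc.normc (f z) ^+ 2.
Proof.
move=> e1; rewrite ler_pdivrMr// -sum_nbrs_cst -big_split mulr_suml/=.
apply: ler_sum => z _.
(* Parallelogram law: the energies for $e$ and $-e$ add up to $2|f(v)|^2 + 2|f(z)|^2$, and the one
   for $-e$ is nonnegative. *)
have := edge_energy_ge0 (- e) f v z.
rewrite !edge_energyE ?sqrrN//; nra.
Qed.

(** Green's formula, for [laplacian] when $e = 1$ and for [signless_laplacian] when $e = -1$. Square
    summability makes all the sums finite, which legitimates the rearrangement. *)
Lemma inner_laplacian e f : e ^+ 2 = 1 -> l2 adj f ->
  complex.Re (inner adj (f - e%:C *: transition adj f) f) =
  fine (\esum_(v in [set: V]) (vertex_energy e f v)%:E) /\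
  (\esum_(v in [set: V]) (vertex_energy e f v)%:E < +oo)%E.
Proof.
move=> e1 l2f.
pose N v : R := Normc.normc (f v) ^+ 2.
have N0 v : 0 <= N v by exact: sqr_ge0.
have N20 v : 0 <= N v / 2 by rewrite divr_ge0.
have finN : (\esum_(v in [set: V]) ((deg adj v)%:R * (N v / 2))%:E < +oo)%E.
  apply: le_lt_trans l2f; apply: le_esum => v _; rewrite lee_fin.
  rewrite ler_wpM2l// /N; have := N0 v; rewrite /N; lra.
have finB : (\esum_(v in [set: V]) (vertex_energy e f v)%:E < +oo)%E.
  apply: (@le_lt_trans _ _ (\esum_(v in [set: V])
      (((deg adj v)%:R * N v)%:E +
       (\sum_(z <- fset_set (nbrs adj v)) N z)%:E))%E).
    apply: le_esum => v _; rewrite -EFinD lee_fin; exact: vertex_energy_le.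
  rewrite esumD; last 2 first.
  - by move=> v _; rewrite lee_fin mulr_ge0.
  - by move=> v _; rewrite lee_fin sumr_ge0.
  by rewrite esum_nbrs//; apply: lte_add_pinfty.
split=> //.
rewrite /inner /csum /=.
(* At each vertex the summand is the vertex energy plus $d(v)|f(v)|^2/2$ minus half the sum of
   $|f|^2$ over the neighbours; the last two terms cancel after summation over all vertices, by
   [esum_nbrs]. *)
rewrite (@rsum_diff _ _ _ (fun v => vertex_energy e f v + (deg adj v)%:R * (N v / 2))
  (fun v => \sum_(z <- fset_set (nbrs adj v)) N z / 2)).
- under eq_esum do rewrite EFinD.
  rewrite esumD; last 2 first.
  + by move=> v _; rewrite lee_fin vertex_energy_ge0.
  + by move=> v _; rewrite lee_fin mulr_ge0.
  rewrite (esum_nbrs N20) fineD ?addrK//.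
  + rewrite ge0_fin_numE//.
    by apply: esum_ge0 => v _; rewrite lee_fin vertex_energy_ge0.
  + rewrite ge0_fin_numE//.
    by apply: esum_ge0 => v _; rewrite lee_fin mulr_ge0.
- by move=> v; apply: addr_ge0; [exact: vertex_energy_ge0|exact: mulr_ge0].
- by move=> v; rewrite sumr_ge0.
- under eq_esum do rewrite EFinD.
  rewrite esumD; last 2 first.
  + by move=> v _; rewrite lee_fin vertex_energy_ge0.
  + by move=> v _; rewrite lee_fin mulr_ge0.
  exact: lte_add_pinfty.
- by rewrite (esum_nbrs N20).
move=> v.
have -> : (deg adj v)%:R * (f - e%:C *: transition adj f) v * (f v)^* =
    (deg adj v)%:R * (f v * (f v)^*) -
    e%:C * \sum_(z <- fset_set (nbrs adj v)) f z * (f v)^*.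
  rewrite -mulr_suml -(transitionE f (deg_gt0 v)).
  have -> : (f - e%:C *: transition adj f) v = f v - e%:C * transition adj f v by [].
  ring.
have -> : complex.Re ((deg adj v)%:R * (f v * (f v)^*) -
    e%:C * \sum_(z <- fset_set (nbrs adj v)) f z * (f v)^*) =
  (deg adj v)%:R * N v -
    e * \sum_(z <- fset_set (nbrs adj v)) complex.Re (f z * (f v)^*).
  have ReB (y z : C) : complex.Re (y - e%:C * z) = complex.Re y - e * complex.Re z.
    by case: y z => [a b] [c d] /=; rewrite mul0r subr0.
  rewrite ReB Re_natrM Re_sum; congr (_ * _ - _).
  by rewrite /N normc_sqr; case: (f v) => a b /=; ring.
rewrite /vertex_energy.
rewrite (eq_bigr _ (fun z _ => edge_energyE f v z e1)).
rewrite sumrB big_split/= sum_nbrs_cst -/(N _) -!mulr_suml -!mulr_sumr.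
by field.
Qed.

Lemma path_inner_le e f v p : e ^+ 2 = 1 -> l2 adj f ->
  path adj v p -> uniq (v :: p) ->
  (Normc.normc (f v) - Normc.normc (f (last v p))) ^+ 2 <=
  (size p)%:R * complex.Re (inner adj (f - e%:C *: transition adj f) f).
Proof.
move=> e1 l2f vp up; apply: le_trans (path_energy_le f e1 vp up) _.
rewrite ler_wpM2l//; have [-> fin] := inner_laplacian e1 l2f.
rewrite -lee_fin fineK; last first.
  by rewrite ge0_fin_numE// esum_ge0// => u _; rewrite lee_fin vertex_energy_ge0.
apply: le_trans (sum_le_esum up (fun u => vertex_energy_ge0 e f u)).
rewrite lee_fin; apply: ler_sum => u _; rewrite ler_pM2r// -big_filter.
apply: ler_sum_uniq_sub => //; first exact: filter_uniq.
- by move=> z; rewrite mem_filter mem_nbrs => /andP[].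
- by move=> z; exact: edge_energy_ge0.
Qed.

Lemma ball_inner_le e f x y r : connected_graph adj -> e ^+ 2 = 1 -> l2 adj f ->
  gball adj x r y ->
  (Normc.normc (f x) - Normc.normc (f y)) ^+ 2 <=
  r%:R * complex.Re (inner adj (f - e%:C *: transition adj f) f).
Proof.
move=> conn e1 l2f; rewrite /gball /gdist /=.
have [n0 walk0] := conn x y.
(* Connectedness provides a shortest walk, which rules out the default value of [gdist]. *)
have [n [walk minimal]] : exists n, has_walk adj x y n /\
    forall m, has_walk adj x y m -> (n <= m)%N.
  pose P m := `[< has_walk adj x y m >].
  have exP : exists m, P m by exists n0; apply/asboolP.
  exists (ex_minn exP); case: ex_minnP => m /asboolP wm min; split=> // k wk.
  by apply: min; apply/asboolP.
case: xgetP => [k -> {n walk minimal} [[p [pp lp sp]] _] kr|]; last first.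
  by move=> /(_ n) /=; case.
(* Removing loops leaves a path with distinct vertices that is no longer than the walk, as
   [path_inner_le] requires. *)
case/shortenP: pp lp => p' pp' up' sub <- {}.
have size_p' : (size p' <= r)%N.
  apply: leq_trans kr; rewrite -sp; apply: uniq_leq_size => //.
  by case/andP: up'.
apply: le_trans (path_inner_le e1 l2f pp' up') _.
have energy_ge0 : 0 <= complex.Re (inner adj (f - e%:C *: transition adj f) f).
  have [-> _] := inner_laplacian e1 l2f; apply: fine_ge0; apply: esum_ge0 => u _.
  by rewrite lee_fin vertex_energy_ge0.
by rewrite ler_wpM2r// ler_nat.
Qed.

End Energy.

(** * Spectral projections *)

Section SpectralProjection.
Context {R : realType} {V : choiceType} (adj : rel V).
Local Notation C := R[i].
Implicit Types (f g : V -> C).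

Lemma inner0l g : inner adj 0 g = 0.
Proof.
rewrite /inner (@csum_seq_support _ _ [::]) ?big_nil// => y _.
by rewrite mulr0 mul0r.
Qed.

Lemma inner_unit_vector f x : (0 < deg adj x)%N ->
  inner adj f (unit_vector adj x) = f x * (Num.sqrt (deg adj x)%:R)%:C.
Proof.
move=> dx; rewrite /inner (@csum_seq_support _ _ [:: x])//; last first.
  move=> y; rewrite inE => /negbTE yx.
  have -> : unit_vector adj x y = 0 :> C by rewrite /unit_vector yx mul0r.
  by rewrite rmorph0 mulr0.
rewrite big_seq1 /unit_vector eqxx mulrAC mulrC; congr (_ * _).
have d0 : 0 < (deg adj x)%:R :> R by rewrite ltr0n.
have -> : (deg adj x)%:R = ((deg adj x)%:R : R)%:C :> C by rewrite rmorph_nat.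
have -> (w : R) : (w%:C)^* = w%:C by exact: conjc_real.
rewrite -rmorphM; congr (_%:C).
rewrite -{1}(sqr_sqrtr (ltW d0)) expr2 [true%:R]mulr1n mul1r mulfK//.
by rewrite gt_eqF// sqrtr_gt0.
Qed.

Lemma l2_unit_vector x : l2 adj (unit_vector adj x : V -> C).
Proof.
rewrite /l2 (@esum_seq_support _ _ [:: x]) ?ltry//.
- by move=> y; rewrite mulr_ge0// sqr_ge0.
- move=> y; rewrite inE => /negbTE yx.
  have -> : unit_vector adj x y = 0 :> C by rewrite /unit_vector yx mul0r.
  by rewrite Normc.normc0 expr0n mulr0.
Qed.

(** The measure $\langle E(\cdot) f, f \rangle$ has total mass $\|f\|^2$ and is carried by [A],
    because $E(A^c) f = E(A^c) E(A) f = E(\emptyset) f = 0$. Integrating $l \le \delta$ against it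
    gives the bound. *)
Lemma spectral_energy_le (T : (V -> C) -> V -> C) E (A : set (measurableTypeR R))
    (delta : R) f :
  spectral_resolution adj T E -> measurable A -> (forall l, A l -> l <= delta) ->
  l2 adj f -> E A f = f ->
  complex.Re (inner adj (T f) f) <= delta * complex.Re (inner adj f f).
Proof.
move=> [[proj E0 ET EI _] spec] mA A_le l2f Af.
have [mu [muE mu_int ->]] := spec f l2f.
have mT : measurable [set: measurableTypeR R] by exact: measurableT.
have muT : mu setT = (complex.Re (inner adj f f))%:E by rewrite muE// ET.
have muAC : mu (~` A) = 0%E.
  rewrite muE; last exact: measurableC.
  by rewrite -Af -EI//; [rewrite setICl E0// Af inner0l|exact: measurableC].
have muA : mu A = (complex.Re (inner adj f f))%:E by rewrite muE// Af.
rewrite [complex.Re _]/= /Rintegral -lee_fin.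
rewrite fineK; last exact: integrable_fin_num.
rewrite (@negligible_integral _ _ _ mu setT (~` A))//; last first.
  exact: measurableC.
rewrite setTD setCK.
apply: (@le_trans _ _ (\int[mu]_(l in A) (delta%:E))%E).
  apply: le_integral => //.
  - exact: integrableS mu_int.
  - apply/integrableP; split; first exact: measurable_cst.
    by rewrite integral_cst//= muA -EFinM ltry.
  - by move=> l Al; rewrite lee_fin A_le// -inE.
by rewrite integral_cst// muA EFinM.
Qed.

(** Idempotence and self-adjointness of the projection. With [inner_unit_vector] it identifies the
    spectral mass $\|f\|^2$ with $f(x) \sqrt{d(x)}$. *)
Lemma spectral_projection_unit (T : (V -> C) -> V -> C) E
    (A : set (measurableTypeR R)) x :
  spectral_resolution adj T E -> measurable A ->
  inner adj (E A (unit_vector adj x)) (unit_vector adj x) =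
  inner adj (E A (unit_vector adj x)) (E A (unit_vector adj x)).
Proof.
move=> [[proj _ _ _ _] _] mA; have [l2E _ idem sym] := proj A mA.
have l2x := l2_unit_vector x.
by rewrite -{1}(idem _ l2x) sym//; exact: l2E.
Qed.

Hypothesis adj_simple : simple_graph adj.
Hypothesis adj_fin : locally_finite_graph adj.
Hypothesis adj_conn : connected_graph adj.
Hypothesis deg_gt0 : forall v, (0 < deg adj v)%N.

(** The common core of the spectral and the random walk bounds. It asks of [f] only low energy and
    $\langle f, e_x \rangle = \|f\|^2$, so it covers both spectral projections of $e_x$ and their
    finite-dimensional analogues extended by zero. *)
Lemma localized_mass_le (e : R) f x (c D delta : R) :
  e ^+ 2 = 1 -> 0 < c -> 1 <= D ->
  (forall r : nat,
    c * (r%:R + 1) `^ D <= \sum_(y \in gball adj x r) ((deg adj y)%:R : R)) ->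
  0 < delta -> l2 adj f ->
  complex.Re (inner adj (f - e%:C *: transition adj f) f) <=
    delta * complex.Re (inner adj f f) ->
  inner adj f (unit_vector adj x) = inner adj f f ->
  complex.Re (inner adj f f) <=
    (D + 1) ^+ 2 / (c `^ (1 / (D + 1)) * D `^ (2 * D / (D + 1)))
    * (deg adj x)%:R * delta `^ (D / (D + 1)).
Proof.
move=> e1 c0 D1 growth d0 l2f energy fx.
have [sym irr] := adj_simple.
have dx0 : 0 < (deg adj x)%:R :> R by rewrite ltr0n.
apply: (spectral_mass_le (F := fun y => Normc.normc (f y)) c0 D1 (deg_gt0 x) growth d0).
- move=> s us; rewrite inner_self /= -lee_fin fineK.
    by apply: (sum_le_esum us) => y; rewrite mulr_ge0 ?sqr_ge0.
  rewrite ge0_fin_numE// esum_ge0// => y _.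
  by rewrite lee_fin mulr_ge0 ?sqr_ge0.
- move=> r y xy.
  apply: le_trans (ball_inner_le sym irr adj_fin deg_gt0 adj_conn e1 l2f xy) _.
  exact: ler_wpM2l.
- rewrite inner_unit_vector// in fx.
  rewrite ler_pdivrMr ?sqrtr_gt0// -fx.
  have s0 : 0 <= Num.sqrt (deg adj x)%:R :> R by exact: sqrtr_ge0.
  case: (f x) => a b /=; rewrite mulr0 subr0 ler_wpM2r//.
  apply: le_trans (ler_norm _) _; rewrite -sqrtr_sqr ler_wsqrtr//.
  by rewrite lerDl sqr_ge0.
Qed.

Lemma spectral_projection_mass_le (T : (V -> C) -> V -> C) E (e : R) x
    (c D delta : R) (A : set (measurableTypeR R)) :
  e ^+ 2 = 1 -> (forall f, T f = f - e%:C *: transition adj f) ->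
  spectral_resolution adj T E ->
  measurable A -> (forall l, A l -> l <= delta) ->
  0 < c -> 1 <= D ->
  (forall r : nat,
    c * (r%:R + 1) `^ D <= \sum_(y \in gball adj x r) ((deg adj y)%:R : R)) ->
  0 < delta ->
  inner adj (E A (unit_vector adj x)) (unit_vector adj x) <=
    ((D + 1) ^+ 2 / (c `^ (1 / (D + 1)) * D `^ (2 * D / (D + 1)))
    * (deg adj x)%:R * delta `^ (D / (D + 1)))%:C.
Proof.
move=> e1 TE specE mA A_le c0 D1 growth d0.
have unitE := spectral_projection_unit x specE mA.
(* The order on complex numbers also demands equal imaginary parts; both vanish here. *)
rewrite unitE lecE; apply/andP; split; first by rewrite inner_self.
have [[proj _ _ _ _] _] := specE; have [l2E _ idem _] := proj A mA.
have l2x := l2_unit_vector x; have l2f := l2E _ l2x.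
apply: (localized_mass_le e1 c0 D1 growth d0) => //.
by rewrite -TE; apply: (spectral_energy_le specE mA A_le) => //; exact: idem.
Qed.

End SpectralProjection.

(** * Return probabilities *)

(** The spectral theorem for the matrix viewed as a complex hermitian one, whose eigenvalues are
    real. The two orthogonality relations express that the eigenvector matrix is unitary on either
    side. *)
Lemma symmetric_eigenbasis {R : realType} n (M : 'M[R]_n) : M^T = M ->
  exists (v : 'I_n -> 'I_n -> R[i]) (l : 'I_n -> R),
    [/\ forall k k', \sum_i v k i * (v k' i)^* = (k == k')%:R,
        forall i j, \sum_k v k i * (v k j)^* = (i == j)%:R &
        forall k i, \sum_j (M i j)%:C * v k j = (l k)%:C * v k i].
Proof.
move=> symM.
pose A : 'M[R[i]]_n := map_mx (real_complex R) M.
have herA : A \is hermsymmx.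
  apply: realsym_hermsym.
    by apply/is_hermitianmxP; rewrite expr0 scale1r map_mx_id// /A map_trmx symM.
  by apply/mxOverP => i j; rewrite mxE; apply/complex_realP; exists (M i j).
pose P := spectralmx A; pose sp := spectral_diag A.
have unitP : P \is unitarymx := spectral_unitarymx A.
have PP : P *m map_mx Num.conj P^T = 1%:M by apply/unitarymxP.
have PP' := mulmx1C PP.
have AE : A = invmx P *m diag_mx sp *m P.
  exact/orthomx_spectralP/hermitian_normalmx.
have AP : A *m map_mx Num.conj P^T = map_mx Num.conj P^T *m diag_mx sp.
  by rewrite {1}AE (invmx_unitary unitP) (mulmxtVK _ unitP).
(* In $A = P^{-1} \mathrm{diag}(sp) P$ with $P$ unitary, the columns of $P^{-1}$ are the conjugated
   rows of $P$. *)
exists (fun k i => (P k i)^*), (fun k => complex.Re (sp 0 k)); split.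
- move=> k k'; have /matrixP/(_ k' k) := PP; rewrite !mxE eq_sym => <-.
  by apply: eq_bigr => i _; rewrite !mxE conjCK mulrC.
- move=> i j; have /matrixP/(_ i j) := PP'; rewrite !mxE => <-.
  by apply: eq_bigr => k _; rewrite !mxE conjCK.
- move=> k i; have /matrixP/(_ i k) := AP.
  rewrite mul_mx_diag !mxE => AEk.
  have spk : sp 0 k \is Num.real.
    exact: (mxOverP (hermitian_spectral_diag_real herA)).
  rewrite (RRe_real spk) mulrC -AEk; apply: eq_bigr => j _; by rewrite !mxE.
Qed.

Lemma parseval {R : realType} n (v : 'I_n -> 'I_n -> R[i]) (a b : 'I_n -> R[i]) :
  (forall k k', \sum_i v k i * (v k' i)^* = (k == k')%:R) ->
  \sum_i (\sum_k a k * v k i) * (\sum_k b k * v k i)^* = \sum_k a k * (b k)^*.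
Proof.
move=> ortho.
under eq_bigr => i _ do rewrite rmorph_sum mulr_suml.
rewrite exchange_big/=; apply: eq_bigr => k _.
under eq_bigr => i _ do rewrite mulr_sumr.
rewrite exchange_big/= (bigD1 k)//= [X in _ + X]big1 ?addr0.
  under eq_bigr => i _ do rewrite rmorphM mulrACA.
  by rewrite -mulr_sumr ortho eqxx mulr1.
move=> k' k'k.
under eq_bigr => i _ do rewrite rmorphM mulrACA.
by rewrite -mulr_sumr ortho eq_sym (negbTE k'k) mulr0.
Qed.

Section ReturnProbability.
Context {R : realType} {V : choiceType} (adj : rel V).
Local Notation C := R[i].
Hypothesis adj_simple : simple_graph adj.
Hypothesis adj_fin : locally_finite_graph adj.
Hypothesis adj_conn : connected_graph adj.
Hypothesis deg_gt0 : forall v, (0 < deg adj v)%N.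

(** Vertices reachable in at most [k] steps, as a list with repetitions; a list is needed to index
    the rows of a matrix. *)
Fixpoint hood (x : V) (k : nat) : seq V :=
  if k is j.+1 then
    hood x j ++ flatten [seq (fset_set (nbrs adj y) : seq V) | y <- hood x j]
  else [:: x].

Lemma hood_adj x k y z : y \in hood x k -> adj y z -> z \in hood x k.+1.
Proof.
move=> yk yz; rewrite /= mem_cat; apply/orP; right; apply/flatten_mapP.
by exists y => //; rewrite mem_nbrs.
Qed.

Lemma hood_leq x k m : (k <= m)%N -> {subset hood x k <= hood x m}.
Proof.
move/subnKC <-; elim: (m - k)%N => [|j IH] y; first by rewrite addn0.
by rewrite addnS /= mem_cat => /IH ->.
Qed.

Variables (x : V) (t : nat).
Let B := undup (hood x t).
Let n := size B.
Let b (i : 'I_n) : V := nth x B i.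

Let b_inj : injective b.
Proof.
by move=> i j /eqP; rewrite /b nth_uniq ?undup_uniq// => /eqP/val_inj.
Qed.

Let b_surj y : y \in B -> exists i, b i = y.
Proof.
move=> yB; have iB : (index y B < n)%N by rewrite index_mem.
by exists (Ordinal iB); rewrite /b/= nth_index.
Qed.

Let sum_b (U : nmodType) (F : V -> U) : \sum_(v <- B) F v = \sum_i F (b i).
Proof. by rewrite (big_nth x) big_mkord. Qed.

Let sum_nbrs_b (F : V -> C) u : (forall z, adj u z -> z \notin B -> F z = 0) ->
  \sum_(z <- fset_set (nbrs adj u)) F z = \sum_i (adj u (b i))%:R * F (b i).
Proof.
move=> F0; rewrite -(sum_b (fun z => (adj u z)%:R * F z)).
rewrite (bigID (mem B))/= [X in _ + X]big_seq_cond [X in _ + X]big1 ?addr0; last first.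
  by move=> z /andP[]; rewrite mem_nbrs// => uz; exact: F0.
under [RHS]eq_bigr do rewrite mulr_natl mulrb.
rewrite -big_mkcond -big_filter -[RHS]big_filter; apply: perm_big.
apply: uniq_perm; rewrite ?filter_uniq ?undup_uniq//.
by move=> z; rewrite !mem_filter mem_nbrs// andbC.
Qed.

Let d (i : 'I_n) : R := (deg adj (b i))%:R.
Let d_gt0 i : 0 < d i. Proof. by rewrite ltr0n. Qed.
Let sd (i : 'I_n) : R := Num.sqrt (d i).
Let sd_gt0 i : 0 < sd i. Proof. by rewrite sqrtr_gt0. Qed.
Let sd_neq0 i : (sd i)%:C != 0 :> C.
Proof. by rewrite fmorph_eq0 gt_eqF. Qed.
Let sd_sqr i : (deg adj (b i))%:R = (sd i)%:C * (sd i)%:C :> C.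
Proof. by rewrite -rmorphM -expr2 sqr_sqrtr ?(ltW (d_gt0 i))// rmorph_nat. Qed.

(** The transition matrix restricted to [B] and conjugated by the square roots of the degrees, which
    makes it symmetric. *)
Let M : 'M[R]_n := \matrix_(i, j) ((adj (b i) (b j))%:R / (sd i * sd j)).

Let M_sym : M^T = M.
Proof.
have [sym _] := adj_simple.
by apply/matrixP => i j; rewrite !mxE sym [sd i * _]mulrC.
Qed.

Let ME i j : (M i j)%:C * (sd i)%:C * (sd j)%:C = (adj (b i) (b j))%:R :> C.
Proof.
rewrite -!rmorphM mxE /= -mulrA divfK ?rmorph_nat//.
by rewrite mulf_neq0 ?gt_eqF.
Qed.

Section Eigenbasis.
Variables (v : 'I_n -> 'I_n -> C) (l : 'I_n -> R) (i0 : 'I_n).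
Hypothesis ortho : forall k k', \sum_i v k i * (v k' i)^* = (k == k')%:R.
Hypothesis complete : forall i j, \sum_k v k i * (v k j)^* = (i == j)%:R.
Hypothesis eigen : forall k i, \sum_j (M i j)%:C * v k j = (l k)%:C * v k i.
Hypothesis b_i0 : b i0 = x.

Let sum_adj_v u k : \sum_j (adj (b u) (b j))%:R / (sd j)%:C * v k j =
  (sd u)%:C * (l k)%:C * v k u.
Proof.
rewrite -mulrA -eigen mulr_sumr; apply: eq_bigr => j _.
by rewrite -ME mulfK// mulrCA mulrA.
Qed.

(** Induction on the number [s] of remaining steps. A walk at distance at most [k] from [x] with $k
    + s \le t$ cannot leave [B], so powers of the truncated matrix give the exact probability; the
    degree ratio in front undoes the symmetrization. *)
Let srw_prob_eigen s k i : (k + s <= t)%N -> b i \in hood x k ->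
  (srw_prob adj s (b i) x : R)%:C =
  (sd i0)%:C / (sd i)%:C * \sum_j (l j)%:C ^+ s * (v j i * (v j i0)^*).
Proof.
elim: s k i => [|s IH] k i kst ik.
  under eq_bigr do rewrite mul1r.
  rewrite complete /= -b_i0 (inj_eq b_inj); case: eqP => [->|_].
    by rewrite divff// mulr1 rmorph1.
  by rewrite mulr0 rmorph0.
have in_B z : adj (b i) z -> z \in B.
  move=> iz; rewrite mem_undup; apply: (@hood_leq _ k.+1).
    by apply: leq_trans kst; rewrite addnS ltnS leq_addr.
  exact: hood_adj iz.
rewrite /= fsbig_finite// rmorph_sum/=.
rewrite sum_nbrs_b; last by move=> z /in_B ->.
transitivity (\sum_j ((sd i)%:C * (sd i)%:C)^-1 * (sd i0)%:C *
    \sum_m (l m)%:C ^+ s * (v m i0)^* * ((adj (b i) (b j))%:R / (sd j)%:C * v m j)).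
  apply: eq_bigr => j _.
  have [ij|_] := boolP (adj (b i) (b j)); last first.
    by rewrite mul0r big1 ?mulr0// => m _; rewrite !mul0r mulr0.
  rewrite mul1r rmorphM/= (IH k.+1); last 2 first.
  - by rewrite addSnnS.
  - exact: hood_adj ij.
  rewrite fmorphV rmorph_nat sd_sqr -!mulrA; congr (_ * (_ * _)).
  rewrite mulr_sumr; apply: eq_bigr => m _; ring.
rewrite -mulr_sumr exchange_big/=.
under eq_bigr do rewrite -mulr_sumr sum_adj_v.
rewrite !mulr_sumr; apply: eq_bigr => m _.
rewrite exprS; field; exact: sd_neq0.
Qed.

Lemma return_prob_eigen :
  srw_prob adj t x x = \sum_k Normc.normc (v k i0) ^+ 2 * l k ^+ t.
Proof.
have := @srw_prob_eigen t 0%N i0 (leqnn t).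
rewrite b_i0 inE eqxx => /(_ isT).
rewrite divff ?sd_neq0// mul1r => /(congr1 (@complex.Re R)) /= ->.
rewrite Re_sum; apply: eq_bigr => k _.
rewrite -rmorphXn normc_sqr; case: (v k i0) => a c /=; ring.
Qed.

(** The test function is the projection of the basis vector at [i0] onto the eigenvectors in [J],
    moved to the graph and extended by zero. It need not be an eigenfunction combination on the
    whole graph, but its energy only involves values on [B] and equals the quadratic form of the
    matrix. *)
Lemma eigen_mass_le (c D e delta : R) (J : pred 'I_n) :
  0 < c -> 1 <= D ->
  (forall r : nat,
    c * (r%:R + 1) `^ D <= \sum_(y \in gball adj x r) ((deg adj y)%:R : R)) ->
  e ^+ 2 = 1 -> 0 < delta -> (forall k, J k -> 1 - e * l k <= delta) ->
  \sum_(k | J k) Normc.normc (v k i0) ^+ 2 <=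
    (D + 1) ^+ 2 / (c `^ (1 / (D + 1)) * D `^ (2 * D / (D + 1)))
    * (deg adj x)%:R * delta `^ (D / (D + 1)).
Proof.
move=> c0 D1 growth e1 delta0 Jle.
(* [al] holds the coefficients of the basis vector at [i0] along the eigenvectors, cut down to [J];
   [g] is the projection. Dividing by [sd] in [f] turns the standard inner product into the one
   weighted by degrees. *)
pose al (k : 'I_n) : C := (J k)%:R * (v k i0)^*.
pose g i := \sum_k al k * v k i.
pose f (y : V) : C := \sum_i (b i == y)%:R * (g i / (sd i)%:C).
have f_out y : y \notin B -> f y = 0.
  move=> yB; apply: big1 => i _; case: eqP => [iy|]; last by rewrite mul0r.
  by move: yB; rewrite -iy /b mem_nth.
have fb i : f (b i) = g i / (sd i)%:C.
  rewrite /f (bigD1 i)//= eqxx mul1r big1 ?addr0// => j ji.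
  by rewrite (inj_eq b_inj) (negbTE ji) mul0r.
have sd_conj i : ((sd i)%:C)^* = (sd i)%:C :> C by exact: conjc_real.
have l2f : l2 adj f.
  rewrite /l2 (@esum_seq_support _ _ B) ?ltry ?undup_uniq//.
  - by move=> y; rewrite mulr_ge0// sqr_ge0.
  - by move=> y /f_out ->; rewrite Normc.normc0 expr0n mulr0.
pose w k := Normc.normc (v k i0) ^+ 2.
have wE k : (v k i0)^* * v k i0 = (w k)%:C.
  rewrite /w normc_sqr; case: (v k i0) => a a' /=.
  by apply/eqP; rewrite eq_complex /=; apply/andP; split; apply/eqP; ring.
have alE k : al k * (al k)^* = (J k)%:R * (w k)%:C.
  rewrite /al rmorphM/= conjCK -wE; case: (J k) => /=.
    by rewrite conjC1; ring.
  by rewrite !mul0r.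
have ReS (F : 'I_n -> R) : \sum_k (J k)%:R * (F k)%:C = (\sum_(k | J k) F k)%:C.
  rewrite rmorph_sum [RHS]big_mkcond/=; apply: eq_bigr => k _.
  by case: (J k); rewrite ?mul1r ?mul0r.
(* As [f] vanishes off [B], pairing with it discards whatever [transition] spreads outside [B]. *)
have inner_fE (h : V -> C) :
    inner adj h f = \sum_i (sd i)%:C * h (b i) * (g i)^*.
  rewrite /inner (@csum_seq_support _ _ B) ?undup_uniq//; last first.
    by move=> y /f_out ->; rewrite rmorph0 mulr0.
  rewrite sum_b; apply: eq_bigr => i _.
  rewrite fb sd_sqr rmorphM/= fmorphV/= sd_conj; field; exact: sd_neq0.
have ff : inner adj f f = (\sum_(k | J k) w k)%:C.
  rewrite inner_fE -ReS -(eq_bigr _ (fun k _ => alE k)) -(parseval al al ortho).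
  by apply: eq_bigr => i _; rewrite fb [_ * (_ / _)]mulrC divfK// sd_neq0.
have -> : \sum_(k | J k) Normc.normc (v k i0) ^+ 2 = complex.Re (inner adj f f).
  by rewrite ff.
apply: (localized_mass_le adj_simple adj_fin adj_conn deg_gt0 e1 c0 D1 growth) => //.
- have -> : inner adj (f - e%:C *: transition adj f) f =
      (\sum_(k | J k) (1 - e * l k) * w k)%:C.
    rewrite inner_fE -ReS.
    transitivity (\sum_k (((1 - e * l k)%:C) * al k) * (al k)^*); last first.
      by apply: eq_bigr => k _; rewrite -mulrA alE [X in _ = _ * X]rmorphM/= mulrCA.
    rewrite -(parseval (fun k => (1 - e * l k)%:C * al k) al ortho); apply: eq_bigr => i _; congr (_ * _).
    have -> : (f - e%:C *: transition adj f) (b i) =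
      f (b i) - e%:C * transition adj f (b i) by [].
    have -> : transition adj f (b i) =
        ((sd i)%:C)^-1 * \sum_k al k * ((l k)%:C * v k i).
      apply: (mulfI (mulf_neq0 (sd_neq0 i) (sd_neq0 i))).
      rewrite -{1}sd_sqr (transitionE adj_fin)// sum_nbrs_b; last first.
        by move=> z _; exact: f_out.
      transitivity (\sum_j \sum_k
          al k * ((adj (b i) (b j))%:R / (sd j)%:C * v k j)).
        apply: eq_bigr => j _; rewrite fb /g mulr_suml mulr_sumr.
        by apply: eq_bigr => k _; ring.
      rewrite exchange_big/=.
      under eq_bigr do rewrite -mulr_sumr sum_adj_v.
      rewrite mulrA mulfK ?sd_neq0// mulr_sumr; apply: eq_bigr => k _; ring.
    rewrite fb mulrBr [_ * (_ / _)]mulrC divfK ?sd_neq0// mulrCA mulVKf ?sd_neq0//.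
    rewrite mulr_sumr -sumrB; apply: eq_bigr => k _.
    rewrite rmorphB rmorphM rmorph1; ring.
  rewrite ff /= mulr_sumr; apply: ler_sum => k /Jle.
  by apply: ler_wpM2r; exact: sqr_ge0.
- rewrite ff inner_unit_vector// -b_i0 fb divfK ?sd_neq0//.
  by rewrite -ReS; apply: eq_bigr => k _; rewrite /al -wE mulrA.
Qed.

End Eigenbasis.

(** From here on the graph enters only through weights and eigenvalues. The sign $e = 1$ bounds the
    mass near eigenvalue $1$, and $e = -1$ the mass near $-1$. *)
Lemma return_prob_spectral (c D : R) : 0 < c -> 1 <= D ->
  (forall r : nat,
    c * (r%:R + 1) `^ D <= \sum_(y \in gball adj x r) ((deg adj y)%:R : R)) ->
  exists (m : nat) (w l : 'I_m -> R),
    [/\ forall k, 0 <= w k,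
        srw_prob adj t x x = \sum_k w k * l k ^+ t &
        forall (e delta : R) (J : pred 'I_m), e ^+ 2 = 1 -> 0 < delta ->
          (forall k, J k -> 1 - e * l k <= delta) ->
          \sum_(k | J k) w k <=
            (D + 1) ^+ 2 / (c `^ (1 / (D + 1)) * D `^ (2 * D / (D + 1)))
            * (deg adj x)%:R * delta `^ (D / (D + 1))].
Proof.
move=> c0 D1 growth.
have [v [l [ortho complete eigen]]] := symmetric_eigenbasis M_sym.
have [i0 b_i0] : exists i, b i = x.
  apply: b_surj; rewrite mem_undup; apply: (@hood_leq _ 0%N) => //.
  by rewrite mem_head.
exists n, (fun k => Normc.normc (v k i0) ^+ 2), l; split.
- by move=> k; exact: sqr_ge0.
- exact: return_prob_eigen complete eigen b_i0.
- move=> e delta J e1 d0 Jle.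
  exact: (eigen_mass_le ortho eigen b_i0 c0 D1 growth e1 d0 Jle).
Qed.

End ReturnProbability.

(** * From eigenvalue masses to the final bounds *)

Lemma connected_infinite_deg_gt0 {V : choiceType} (adj : rel V) (v : V) :
  locally_finite_graph adj -> connected_graph adj -> infinite_set [set: V] ->
  (0 < deg adj v)%N.
Proof.
move=> adj_fin conn inf; rewrite lt0n; apply/negP => /eqP dv0.
(* Without neighbours, every walk from [v] stays at [v], so connectedness would reduce the graph to
   one vertex. *)
apply: inf; apply: (@sub_finite_set _ _ [set v]); last exact: finite_set1.
move=> y _ /=; have [k [[|z p] [/= vp <- _]]] := conn v y => //.
have : z \in fset_set (nbrs adj v) by rewrite mem_nbrs//; case/andP: vp.
by move: dv0; rewrite /deg => /cardfs0_eq ->.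
Qed.

(* Since $1 - u \le e^{-u}$, the $t$-th powers of the eigenvalues of one sign are
   dominated by a Laplace transform of their distance to $\pm 1$. *)
Lemma moment_sum_le {R : realType} (I : finType) (w l : I -> R) (a K : R) (t : nat) :
  0 < a <= 1 -> 0 < K -> (0 < t)%N -> (forall k, 0 <= w k) ->
  (forall (delta : R) (J : pred I), 0 < delta ->
     (forall k, J k -> 1 - l k <= delta) -> \sum_(k | J k) w k <= K * delta `^ a) ->
  \sum_(k | 0 <= l k) w k * l k ^+ t <= K * a * Gamma a * t%:R `^ (- a).
Proof.
move=> a01 K0 t0 w0 mass.
have tR : 0 < t%:R :> R by rewrite ltr0n.
apply: le_trans (_ : \sum_(k | 0 <= l k) w k * expR (- (t%:R * (1 - l k))) <= _).
  apply: ler_sum => k lk; rewrite ler_wpM2l// -mulrN opprB expRM_natl.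
  apply: lerXn2r; rewrite ?nnegrE ?expR_ge0//.
  by have := expR_ge1Dx (l k - 1); rewrite addrC subrK.
have -> : K * a * Gamma a * t%:R `^ (- a) = (K * t%:R `^ (- a)) * a * Gamma a by ring.
(* The atoms sit at $t(1 - l_k)$, so their mass up to $r$ is the mass within $r/t$ of eigenvalue
   $1$; this rescaling produces the factor $t^{-a}$. *)
rewrite -big_filter; apply: (laplace_sum_le (K := K * t%:R `^ (- a))) => //.
  by rewrite mulr_gt0// powR_gt0.
move=> r r0; rewrite big_filter_cond.
have -> : K * t%:R `^ (- a) * r `^ a = K * (r / t%:R) `^ a.
  rewrite -mulrA; congr (_ * _).
  have -> : r `^ a = (r / t%:R) `^ a * t%:R `^ a.
    by rewrite -powRM ?ler0n ?ltW ?divr_gt0// divfK// gt_eqF.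
  by rewrite powRN mulrCA mulVf ?mulr1// gt_eqF// powR_gt0.
apply: mass => [|k /andP[_]]; first by rewrite divr_gt0.
by rewrite ler_pdivlMr// mulrC.
Qed.

Theorem proposition1p3 (R : realType) (V : choiceType) (adj : rel V)
  (adj_simple : simple_graph adj)
  (adj_locally_finite : locally_finite_graph adj)
  (adj_connected : connected_graph adj)
  (V_infinite : infinite_set [set: V])
  (adj_nonbipartite : ~ bipartite_graph adj)
  (x : V) (c D : R) (c_gt0 : 0 < c) (D_ge1 : 1 <= D)
  (growth : forall r : nat,
    c * (r%:R + 1) `^ D <= \sum_(y \in gball adj x r) ((deg adj y)%:R : R)) :
  let C : R :=
    (D + 1) ^+ 2 / (c `^ (1 / (D + 1)) * D `^ (2 * D / (D + 1))) in
  let C' : R :=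
    (D + 1) / (c `^ (1 / (D + 1)) * D `^ ((D - 1) / (D + 1)))
      * Gamma (D / (D + 1)) in
  [/\ forall I_L, spectral_resolution adj (laplacian adj) I_L ->
        forall delta : R, 0 < delta < 2 ->
        mu_star adj I_L x delta
          <= (C * (deg adj x)%:R * delta `^ (D / (D + 1)))%:C,
      forall I_Q, spectral_resolution adj (signless_laplacian adj) I_Q ->
        forall delta : R, 0 < delta < 2 ->
        mu_Q adj I_Q x delta
          <= (C * (deg adj x)%:R * delta `^ (D / (D + 1)))%:C &
      forall t : nat, (1 <= t)%N ->
        (~~ odd t -> srw_prob adj t x x
          <= 2 * C' * (deg adj x)%:R * t%:R `^ (- (D / (D + 1)))) /\
        (odd t -> srw_prob adj t x x
          <= C' * (deg adj x)%:R * t%:R `^ (- (D / (D + 1))))].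

Proof.
move=> C C'.
have D0 : 0 < D by exact: lt_le_trans D_ge1.
have D1 : 0 < D + 1 by rewrite addr_gt0.
have deg0 v : (0 < deg adj v)%N by exact: connected_infinite_deg_gt0.
have signs : (1 : R) ^+ 2 = 1 /\ (-1 : R) ^+ 2 = 1 by rewrite expr1n sqrrN expr1n.
split.
- move=> I_L specL delta /andP[delta0 _].
  apply: (spectral_projection_mass_le adj_simple adj_locally_finite
    adj_connected deg0 (T := laplacian adj) (e := 1)) => //.
  + by case: signs.
  + by move=> f; rewrite rmorph1 scale1r.
  + by move=> l; rewrite /= in_itv/= => /andP[].
- move=> I_Q specQ delta /andP[delta0 _].
  apply: (spectral_projection_mass_le adj_simple adj_locally_finite
    adj_connected deg0 (T := signless_laplacian adj) (e := -1)) => //.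
  + by case: signs.
  + by move=> f; rewrite rmorphN rmorph1 scaleN1r opprK.
  + by move=> l; rewrite /= in_itv/= => /andP[].
move=> t t1.
have [m [w [l [w0 probE mass]]]] := return_prob_spectral adj_simple
  adj_locally_finite adj_connected deg0 t c_gt0 D_ge1 growth.
set d : R := (deg adj x)%:R in mass *.
have d0 : 0 < d by rewrite ltr0n.
pose a := D / (D + 1).
have a01 : 0 < a <= 1.
  by rewrite divr_gt0//= ler_pdivrMr// mul1r lerDl.
have C0 : 0 < C.
  by rewrite divr_gt0// ?exprn_gt0// mulr_gt0// powR_gt0.
(* The Gamma integral brings the factor $a = D/(D+1)$, which cancels one power of $D+1$ and one of
   $D$ in [C]. *)
have C'E : C' = C * a * Gamma a.
  rewrite /C' /C /a; congr (_ * _).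
  have -> : D `^ (2 * D / (D + 1)) = D `^ ((D - 1) / (D + 1)) * D.
    have -> : 2 * D / (D + 1) = (D - 1) / (D + 1) + 1 by field; rewrite gt_eqF.
    by rewrite powRD ?powRr1 ?(ltW D0)// (gt_eqF D0) implybT.
  field; rewrite !gt_eqF// powR_gt0//.
have half (e : R) : e ^+ 2 = 1 ->
    \sum_(k | 0 <= e * l k) w k * (e * l k) ^+ t <= C' * d * t%:R `^ (- a).
  move=> e1.
  have -> : C' * d * t%:R `^ (- a) = (C * d) * a * Gamma a * t%:R `^ (- a).
    by rewrite C'E; ring.
  apply: moment_sum_le => //; first by rewrite mulr_gt0.
  by move=> delta J delta0 Jle; exact: mass Jle.
split=> [even_t|odd_t].
- rewrite probE.
  (* For even $t$ all terms are nonnegative and both ends of the spectrum contribute, whence the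
     factor $2$. A zero eigenvalue falls in both sums, harmlessly for an upper bound. *)
  apply: le_trans (_ : \sum_(k | 0 <= 1 * l k) w k * (1 * l k) ^+ t +
    \sum_(k | 0 <= -1 * l k) w k * (-1 * l k) ^+ t <= _); last first.
    have := half _ signs.1; have := half _ signs.2; lra.
  rewrite [X in _ <= X + _]big_mkcond [X in _ <= _ + X]big_mkcond -big_split/=; apply: ler_sum => k _.
  rewrite mul1r mulN1r exprNn -signr_odd (negbTE even_t) expr0 mul1r.
  have lt0 : 0 <= w k * l k ^+ t by rewrite mulr_ge0// exprn_even_ge0.
  rewrite oppr_ge0; case: ifP => [_|/negbT]; first by rewrite lerDl; case: ifP.
  by rewrite -ltNge => /ltW ->; rewrite add0r.
- rewrite probE; apply: le_trans (half _ signs.1).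
  (* For odd $t$ the negative eigenvalues contribute nonpositive terms, which are dropped. *)
  rewrite [leRHS]big_mkcond; apply: ler_sum => k _; rewrite mul1r.
  case: ifP => [//|/negbT]; rewrite -ltNge => lk.
  by rewrite mulr_ge0_le0// exprn_odd_le0// ltW.
Qed.
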